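(* Let $p$ be a prime, let $n\in\mathbb{N}$, $n\ge 1$, and let $\mathfrak{S}\subset GL(n,\mathbb{Q}_p)$ be a semigroup. Let $\mathcal{D}=\{b\,\mathrm{Id}\mid b\in\mathbb{Q}_p\setminus\{0\}\}$ be the centre of $GL(n,\mathbb{Q}_p)$, and let $GL(n,\mathbb{Q}_p)$ act on the $p$-adic unit sphere $\mathcal{S}_n$ by $T\mapsto\overline{T}$, where $\overline{T}(x)=\|T(x)\|_p\,T(x)$ for $x\in\mathcal{S}_n$. Then the following are equivalent: (i) $\mathfrak{S}$ acts distally on $\mathcal{S}_n$. (ii) The group generated by $\mathfrak{S}$ in $GL(n,\mathbb{Q}_p)$ acts distally on $\mathcal{S}_n$. (iii) The closure of $(\mathfrak{S}\mathcal{D})/\mathcal{D}$ in $PGL(n,\mathbb{Q}_p)=GL(n,\mathbb{Q}_p)/\mathcal{D}$ is a compact group.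
   Context: Here $|\cdot|_p$ is the $p$-adic absolute value on $\mathbb{Q}_p$, and for $x=(x_1,\dots,x_n)\in\mathbb{Q}_p^n$, $\|x\|_p=\max_{1\le i\le n}|x_i|_p$. The $p$-adic unit sphere is $\mathcal{S}_n=\{x\in\mathbb{Q}_p^n\mid\|x\|_p=1\}$. For nonzero $v\in\mathbb{Q}_p^n$, $\|v\|_p$ is an integer power $p^m$ of $p$, and in the expression $\|v\|_p\,v$ this power is regarded as the scalar $p^m\in\mathbb{Q}_p$; thus $\|v\|_p\,v$ has norm $1$. For $T\in GL(n,\mathbb{Q}_p)$, $\overline{T}$ is a homeomorphism of $\mathcal{S}_n$, and $T\mapsto\overline{T}$ is a group homomorphism defining a continuous action of $GL(n,\mathbb{Q}_p)$ on $\mathcal{S}_n$. A semigroup in a group is a nonempty subset closed under multiplication. A semigroup $\mathcal{H}$ of homeomorphisms of a Hausdorff topological space $X$ acts distally on $X$ if for every pair of distinct $x,y\in X$, the closure of $\{(h(x),h(y))\mid h\in\mathcal{H}\}$ in $X\times X$ does not intersect the diagonal $\{(d,d)\mid d\in X\}$. A semigroup (or group) $\mathfrak{S}\subset GL(n,\mathbb{Q}_p)$ acts distally on $\mathcal{S}_n$ if $\{\overline{T}\mid T\in\mathfrak{S}\}$ does. $GL(n,\mathbb{Q}_p)$ carries its usual $p$-adic topology and $PGL(n,\mathbb{Q}_p)$ the quotient topology. *)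

(* Defs.v *)
From HB Require Import structures.
From mathcomp Require Import all_boot all_order all_algebra generic_quotient.
From mathcomp Require Import all_classical all_reals topology.

Set Implicit Arguments.
Unset Strict Implicit.
Unset Printing Implicit Defensive.

Import Order.TTheory GRing.Theory Num.Theory.

Local Open Scope classical_set_scope.
Local Open Scope ring_scope.

(* Q_p is built as the fraction field of Z_p = lim Z/p^k. An element of Z_p is
   the sequence of its residues: x k is the representative in [0, p^k) of its
   class modulo p^k (the condition below forces x k < p^k). *)

Record Zp (p : nat) (p_pr : prime p) := MkZp {
  Zp_res :> nat -> nat;
  _ : `[< forall k, (Zp_res k.+1 %% p ^ k)%N = Zp_res k >]
}.

HB.instance Definition _ p (p_pr : prime p) := [isSub for @Zp_res p p_pr].
HB.instance Definition _ p (p_pr : prime p) := gen_eqMixin (Zp p_pr).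
HB.instance Definition _ p (p_pr : prime p) := gen_choiceMixin (Zp p_pr).

Section ZpRing.
Variables (p : nat) (p_pr : prime p).
Local Notation Zp := (Zp p_pr).
Implicit Types x y z : Zp.

Let pk_gt0 k : (0 < p ^ k)%N.
Proof. by rewrite expn_gt0 prime_gt0. Qed.

Lemma Zp_resS x k : (x k.+1 %% p ^ k)%N = x k.
Proof. by case: x => x /= /asboolP. Qed.

Lemma Zp_res_mod x j k : (j <= k)%N -> (x k %% p ^ j)%N = x j.
Proof.
move=> /subnK <-; elim: (k - j)%N => [|i IHi]; rewrite ?add0n ?addSn.
  by rewrite -(Zp_resS x j) modn_mod.
by rewrite -IHi -(Zp_resS x (i + j)) modn_dvdm// dvdn_exp2l// leq_addl.
Qed.

Lemma Zp_modE x k : (x k %% p ^ k)%N = x k.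
Proof. exact: Zp_res_mod. Qed.

Lemma Zp_eqP x y : (forall k, x k = y k) -> x = y.
Proof. by move=> xy; apply/val_inj/funext. Qed.

Fact Zp_mk_subproof (f : nat -> nat) :
  (forall k, f k.+1 = f k %[mod p ^ k]) ->
  `[< forall k, ((f k.+1 %% p ^ k.+1) %% p ^ k)%N = (f k %% p ^ k)%N >].
Proof.
move=> fE; apply/asboolP => k.
by rewrite modn_dvdm ?fE// dvdn_exp2l.
Qed.

Definition Zp_mk f fE : Zp := MkZp p_pr (@Zp_mk_subproof f fE).

Definition Zp_zero : Zp := @Zp_mk (fun=> 0%N) (fun=> erefl).
Definition Zp_one : Zp := @Zp_mk (fun=> 1%N) (fun=> erefl).

Fact Zp_add_subproof x y k : (x k.+1 + y k.+1 = x k + y k %[mod p ^ k])%N.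
Proof. by rewrite -(Zp_resS x k) -(Zp_resS y k) modnDm. Qed.
Definition Zp_add x y : Zp := Zp_mk (Zp_add_subproof x y).

Fact Zp_mul_subproof x y k : (x k.+1 * y k.+1 = x k * y k %[mod p ^ k])%N.
Proof. by rewrite -(Zp_resS x k) -(Zp_resS y k) modnMm. Qed.
Definition Zp_mul x y : Zp := Zp_mk (Zp_mul_subproof x y).

Let Zp_lt x k : (x k < p ^ k)%N.
Proof. by rewrite -(Zp_modE x k) ltn_mod. Qed.

Fact Zp_opp_subproof x k : (p ^ k.+1 - x k.+1 = p ^ k - x k %[mod p ^ k])%N.
Proof.
apply/eqP; rewrite -(eqn_modDr (x k.+1)) subnK ?(ltnW (Zp_lt _ _))//.
rewrite -modnDmr Zp_resS subnK ?(ltnW (Zp_lt _ _))//.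
by rewrite modnn expnS modnMl.
Qed.
Definition Zp_opp x : Zp := Zp_mk (Zp_opp_subproof x).

Fact Zp_addA : associative Zp_add.
Proof. by move=> x y z; apply: Zp_eqP => k /=; rewrite modnDml modnDmr addnA. Qed.
Fact Zp_addC : commutative Zp_add.
Proof. by move=> x y; apply: Zp_eqP => k /=; rewrite addnC. Qed.
Fact Zp_add0 : left_id Zp_zero Zp_add.
Proof. by move=> x; apply: Zp_eqP => k /=; rewrite mod0n add0n Zp_modE. Qed.
Fact Zp_addN : left_inverse Zp_zero Zp_opp Zp_add.
Proof.
move=> x; apply: Zp_eqP => k /=.
by rewrite modnDml subnK ?(ltnW (Zp_lt _ _))// modnn mod0n.
Qed.
HB.instance Definition _ :=
  GRing.isZmodule.Build Zp Zp_addA Zp_addC Zp_add0 Zp_addN.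

Fact Zp_mulA : associative Zp_mul.
Proof. by move=> x y z; apply: Zp_eqP => k /=; rewrite modnMml modnMmr mulnA. Qed.
Fact Zp_mulC : commutative Zp_mul.
Proof. by move=> x y; apply: Zp_eqP => k /=; rewrite mulnC. Qed.
Fact Zp_mul1 : left_id Zp_one Zp_mul.
Proof. by move=> x; apply: Zp_eqP => k /=; rewrite modnMml mul1n Zp_modE. Qed.
Fact Zp_mulDl : left_distributive Zp_mul Zp_add.
Proof.
by move=> x y z; apply: Zp_eqP => k /=; rewrite modnMml modnDm mulnDl.
Qed.
Fact Zp_one_neq0 : Zp_one != 0.
Proof.
apply/eqP => /(congr1 (fun x : Zp => x 1%N)) /=.
by rewrite expn1 mod0n modn_small ?prime_gt1.
Qed.
HB.instance Definition _ := GRing.Zmodule_isComNzRing.Build Zp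
  Zp_mulA Zp_mulC Zp_mul1 Zp_mulDl Zp_one_neq0.

Lemma Zp_res0 k : (0 : Zp) k = 0%N.
Proof. by rewrite [LHS]mod0n. Qed.

Lemma Zp_resD x y k : (x + y) k = ((x k + y k) %% p ^ k)%N.
Proof. by []. Qed.

Lemma Zp_resM x y k : (x * y) k = ((x k * y k) %% p ^ k)%N.
Proof. by []. Qed.

Lemma Zp_res_nat m k : (m%:R : Zp) k = (m %% p ^ k)%N.
Proof.
elim: m => [|m IHm]; first by rewrite Zp_res0 mod0n.
by rewrite -addn1 natrD Zp_resD IHm modnDm.
Qed.

Lemma Zp_neq0P x : x <> 0 -> exists k, x k.+1 != 0%N.
Proof.
apply: contra_notP => /forallNP x0; apply: Zp_eqP => k; rewrite Zp_res0.
rewrite -(Zp_resS x k); have /negP := x0 k.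
by rewrite negbK => /eqP ->; rewrite mod0n.
Qed.

(* The p-adic valuation of x: the largest k such that x = 0 modulo p^k (0 if x = 0). *)
Definition Zp_val x : nat :=
  if pselect (exists k, x k.+1 != 0%N) is left e then ex_minn e else 0%N.

Lemma Zp_valP x k : x <> 0 -> (x k == 0%N) = (k <= Zp_val x)%N.
Proof.
move=> /Zp_neq0P ex; rewrite /Zp_val; case: pselect => // e.
case: ex_minnP => m xm mP; case: (leqP k m) => [km|mk].
  rewrite -(Zp_res_mod x km); case: m xm mP km => [|m] xm mP km.
    by move: km; rewrite leqn0 => /eqP ->; rewrite expn0 modn1.
  have /eqP -> : x m.+1 == 0%N; last by rewrite mod0n.
  by apply: contraT => /mP; rewrite ltnn.
apply/negbTE; apply: contra xm => /eqP xk0.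
by rewrite -(Zp_res_mod x mk) xk0 mod0n.
Qed.

Lemma Zp_val_uniq x m : x m = 0%N -> x m.+1 != 0%N -> Zp_val x = m.
Proof.
move=> x0 x1; have xn0 : x <> 0.
  by move=> xE; move: x1; rewrite xE Zp_res0.
apply/eqP; rewrite eqn_leq -Zp_valP// x0 eqxx andbT.
by rewrite leqNgt -Zp_valP.
Qed.

Lemma Zp_mul_val x y : x <> 0 -> y <> 0 ->
  (x * y) (Zp_val x + Zp_val y)%N = 0%N /\
  (x * y) (Zp_val x + Zp_val y).+1 != 0%N.
Proof.
move=> x0 y0; set a := Zp_val x; set b := Zp_val y.
have dvdP (z : Zp) c k : (c <= k)%N -> (p ^ c %| z k)%N = (z c == 0%N).
  by move=> ck; rewrite /dvdn Zp_res_mod.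
split.
  apply/eqP; rewrite Zp_resM -/(dvdn _ _) expnD dvdn_mul//.
    by rewrite dvdP ?leq_addr// Zp_valP.
  by rewrite dvdP ?leq_addl// Zp_valP.
rewrite Zp_resM -/(dvdn _ _).
have /dvdnP[u xE] : (p ^ a %| x (a + b).+1)%N.
  by rewrite dvdP ?Zp_valP// -addnS leq_addr.
have /dvdnP[v yE] : (p ^ b %| y (a + b).+1)%N.
  by rewrite dvdP ?Zp_valP// -addSn leq_addl.
have pu : ~~ (p %| u)%N.
  rewrite -(@dvdn_pmul2r (p ^ a)) ?pk_gt0// -xE -expnS.
  by rewrite dvdP ?Zp_valP// ?ltnn// ltnS leq_addr.
have pv : ~~ (p %| v)%N.
  rewrite -(@dvdn_pmul2r (p ^ b)) ?pk_gt0// -yE -expnS.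
  by rewrite dvdP ?Zp_valP// ?ltnn// ltnS leq_addl.
rewrite xE yE mulnACA -expnD expnS dvdn_pmul2r ?pk_gt0//.
by rewrite Euclid_dvdM// (negbTE pu) (negbTE pv).
Qed.

Fact Zp_mulf_eq0 x y : x * y = 0 -> (x == 0) || (y == 0).
Proof.
move=> xy0; apply/orP; case: (eqVneq x 0) => [|/eqP x0]; [by left|right].
apply: contraT => /eqP y0; have [_] := Zp_mul_val x0 y0.
by rewrite xy0 Zp_res0.
Qed.

Lemma Zp_valM x y : x <> 0 -> y <> 0 ->
  Zp_val (x * y) = (Zp_val x + Zp_val y)%N.
Proof. by move=> x0 y0; have [] := Zp_mul_val x0 y0; exact: Zp_val_uniq. Qed.

Definition Zp_unit : {pred Zp} := fun x => `[< exists y, y * x = 1 >].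
Definition Zp_inv x : Zp :=
  if pselect (exists y, y * x = 1) is left e then sval (cid e) else x.

Fact Zp_mulV : {in Zp_unit, left_inverse 1 Zp_inv *%R}.
Proof.
by move=> x /asboolP ex; rewrite /Zp_inv; case: pselect => // e; case: cid.
Qed.
Fact Zp_unitP x y : y * x = 1 -> Zp_unit x.
Proof. by move=> yx; apply/asboolP; exists y. Qed.
Fact Zp_inv_out : {in [predC Zp_unit], Zp_inv =1 id}.
Proof.
move=> x /negP xu; rewrite /Zp_inv; case: pselect => // e.
by case: xu; apply/asboolP.
Qed.
HB.instance Definition _ := GRing.ComNzRing_hasMulInverse.Build Zp
  Zp_mulV Zp_unitP Zp_inv_out.
HB.instance Definition _ :=
  GRing.ComUnitRing_isIntegral.Build Zp Zp_mulf_eq0.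

Definition Zp_abs x : rat := if x == 0 then 0 else p%:R ^- Zp_val x.

Let p_neq0 : p%:R != 0 :> rat.
Proof. by rewrite pnatr_eq0 -lt0n prime_gt0. Qed.

Let p_gt0 : 0 < p%:R :> rat.
Proof. by rewrite ltr0n prime_gt0. Qed.

Let p_ge1 : 1 <= p%:R :> rat.
Proof. by rewrite ler1n prime_gt0. Qed.

Lemma Zp_abs0 : Zp_abs 0 = 0.
Proof. by rewrite /Zp_abs eqxx. Qed.

Lemma Zp_abs_ge0 x : 0 <= Zp_abs x.
Proof. by rewrite /Zp_abs; case: eqP => // _; rewrite invr_ge0 exprn_ge0// ltW. Qed.

Lemma Zp_abs_eq0 x : (Zp_abs x == 0) = (x == 0).
Proof.
rewrite /Zp_abs; case: (eqVneq x 0) => [_|_]; first by rewrite eqxx.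
by rewrite invr_eq0 expf_eq0 (negbTE p_neq0) andbF.
Qed.

Lemma Zp_absM x y : Zp_abs (x * y) = Zp_abs x * Zp_abs y.
Proof.
rewrite /Zp_abs mulf_eq0; case: eqP => [_|x0]; first by rewrite mul0r.
case: eqP => [_|y0]; first by rewrite mulr0.
by rewrite Zp_valM// exprD invfM.
Qed.

Lemma Zp_abs_le x k : (Zp_abs x <= p%:R ^- k) = (x k == 0%N).
Proof.
rewrite /Zp_abs; case: eqP => [->|x0].
  by rewrite Zp_res0 eqxx invr_ge0 exprn_ge0// ltW.
rewrite Zp_valP// lef_pV2 ?posrE ?exprn_gt0//.
by rewrite ler_eXn2l// ltr1n prime_gt1.
Qed.

Lemma Zp_absD x y : Zp_abs (x + y) <= Num.max (Zp_abs x) (Zp_abs y).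
Proof.
wlog xy : x y / Zp_abs x <= Zp_abs y.
  move=> H; case/orP: (le_total (Zp_abs x) (Zp_abs y)) => [/H//|/H].
  by rewrite addrC maxC.
rewrite max_r//; case: (eqVneq y 0) => [y0|y0].
  move: xy; rewrite y0 Zp_abs0 => xy.
  by rewrite addr0.
have yE : Zp_abs y = p%:R ^- Zp_val y by rewrite /Zp_abs (negbTE y0).
have /eqP y1 : y (Zp_val y) == 0%N by rewrite -Zp_abs_le yE.
move: xy; rewrite yE !Zp_abs_le => /eqP x1.
by rewrite Zp_resD x1 y1 mod0n.
Qed.

Lemma Zp_abs1 : Zp_abs 1 = 1.
Proof.
by apply/(@mulfI _ (Zp_abs 1)); rewrite ?Zp_abs_eq0 ?oner_neq0// mulr1 -Zp_absM mulr1.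
Qed.

Lemma Zp_absN x : Zp_abs (- x) = Zp_abs x.
Proof.
have N1 : Zp_abs (-1) = 1.
  apply/eqP; rewrite -(@eqrXn2 _ 2)// ?Zp_abs_ge0// expr1n expr2.
  by rewrite -Zp_absM mulrNN mulr1 Zp_abs1.
by rewrite -mulN1r Zp_absM N1 mul1r.
Qed.

Lemma Zp_abs_p : Zp_abs p%:R = p%:R^-1.
Proof.
have v1 : Zp_val (p%:R : Zp) = 1%N.
  apply: Zp_val_uniq; rewrite Zp_res_nat ?expn1 ?modnn//.
  by rewrite modn_small -?lt0n ?prime_gt0// -[ltnLHS]expn1 ltn_exp2l// prime_gt1.
rewrite /Zp_abs v1 expr1; case: eqP => // p0; move: v1.
by move=> v1; have := Zp_res_nat p 2; rewrite p0 Zp_res0 modn_small;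
  [move=> E; have := prime_gt0 p_pr; rewrite -E|rewrite -[ltnLHS]expn1 ltn_exp2l// prime_gt1].
Qed.

End ZpRing.

(* A wrapper around {fraction Zp p_pr}, so that unification does not unfold the
   operations of the latter. *)
Record Qp (p : nat) (p_pr : prime p) :=
  MkQp { Qp_frac : {fraction (Zp p_pr)} }.

HB.instance Definition _ p (p_pr : prime p) := gen_eqMixin (Qp p_pr).
HB.instance Definition _ p (p_pr : prime p) := gen_choiceMixin (Qp p_pr).

Section QpField.
Variables (p : nat) (p_pr : prime p).
Local Notation Qp := (Qp p_pr).
Implicit Types x y z : Qp.

Lemma Qp_frac_inj : injective (@Qp_frac p p_pr).
Proof. by move=> [x] [y] /= ->. Qed.

Definition Qp_zero : Qp := MkQp 0.
Definition Qp_one : Qp := MkQp 1.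
Definition Qp_opp x : Qp := MkQp (- Qp_frac x).
Definition Qp_add x y : Qp := MkQp (Qp_frac x + Qp_frac y).
Definition Qp_mul x y : Qp := MkQp (Qp_frac x * Qp_frac y).
Definition Qp_inv x : Qp := MkQp (Qp_frac x)^-1.

Fact Qp_addA : associative Qp_add.
Proof. by move=> x y z; apply: Qp_frac_inj; exact: addrA. Qed.
Fact Qp_addC : commutative Qp_add.
Proof. by move=> x y; apply: Qp_frac_inj; exact: addrC. Qed.
Fact Qp_add0 : left_id Qp_zero Qp_add.
Proof. by move=> x; apply: Qp_frac_inj; exact: add0r. Qed.
Fact Qp_addN : left_inverse Qp_zero Qp_opp Qp_add.
Proof. by move=> x; apply: Qp_frac_inj; exact: addNr. Qed.
HB.instance Definition _ :=
  GRing.isZmodule.Build Qp Qp_addA Qp_addC Qp_add0 Qp_addN.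

Fact Qp_mulA : associative Qp_mul.
Proof. by move=> x y z; apply: Qp_frac_inj; exact: mulrA. Qed.
Fact Qp_mulC : commutative Qp_mul.
Proof. by move=> x y; apply: Qp_frac_inj; exact: mulrC. Qed.
Fact Qp_mul1 : left_id Qp_one Qp_mul.
Proof. by move=> x; apply: Qp_frac_inj; exact: mul1r. Qed.
Fact Qp_mulDl : left_distributive Qp_mul Qp_add.
Proof. by move=> x y z; apply: Qp_frac_inj; exact: mulrDl. Qed.
Fact Qp_one_neq0 : Qp_one != 0.
Proof.
by apply/eqP => /(congr1 (@Qp_frac p p_pr)) /= /eqP; apply/negP/oner_neq0.
Qed.
HB.instance Definition _ := GRing.Zmodule_isComNzRing.Build Qp
  Qp_mulA Qp_mulC Qp_mul1 Qp_mulDl Qp_one_neq0.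

Fact Qp_mulV x : x != 0 -> Qp_mul (Qp_inv x) x = 1.
Proof.
move=> /eqP x0; apply: Qp_frac_inj; apply: mulVf.
by apply/eqP => /= x0'; apply: x0; apply: Qp_frac_inj.
Qed.
Fact Qp_inv0 : Qp_inv 0 = 0.
Proof. by apply: Qp_frac_inj; exact: invr0. Qed.
HB.instance Definition _ := GRing.ComNzRing_isField.Build Qp Qp_mulV Qp_inv0.

End QpField.

Section QpAbs.
Variables (p : nat) (p_pr : prime p).
Local Notation Zp := (Zp p_pr).
Local Notation Qp := (Qp p_pr).
Implicit Types x y z : Qp.

Definition Zp_to_Qp (a : Zp) : Qp := MkQp (FracField.tofrac a).
Local Notation "a %:F" := (Zp_to_Qp a).

Fact Zp_to_Qp_is_zmod_morphism : zmod_morphism Zp_to_Qp.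
Proof. by move=> a b; apply: Qp_frac_inj; exact: tofracB. Qed.
Fact Zp_to_Qp_is_monoid_morphism : monoid_morphism Zp_to_Qp.
Proof.
by split=> [|a b]; apply: Qp_frac_inj; [exact: tofrac1|exact: tofracM].
Qed.
HB.instance Definition _ :=
  GRing.isZmodMorphism.Build Zp Qp Zp_to_Qp Zp_to_Qp_is_zmod_morphism.
HB.instance Definition _ :=
  GRing.isMonoidMorphism.Build Zp Qp Zp_to_Qp Zp_to_Qp_is_monoid_morphism.

Lemma Zp_to_Qp_inj : injective Zp_to_Qp.
Proof.
by move=> a b /(congr1 (@Qp_frac p p_pr)) /= /eqP; rewrite tofrac_eq => /eqP.
Qed.

Lemma Zp_to_Qp_eq0 a : (a%:F == 0) = (a == 0).
Proof. by rewrite -(rmorph0 Zp_to_Qp) (inj_eq Zp_to_Qp_inj). Qed.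

Let numer x : Zp := (frac (repr (Qp_frac x))).1.
Let denom x : Zp := (frac (repr (Qp_frac x))).2.

Let denom_neq0 x : denom x != 0.
Proof. exact: denom_ratioP. Qed.

Let piM_denom (r : {ratio Zp}) :
  (\pi_({fraction Zp}) r)%qT * FracField.tofrac (frac r).2 =
  FracField.tofrac (frac r).1.
Proof.
change (FracField.mul (\pi r)%qT (FracField.tofrac (frac r).2) =
  FracField.tofrac (frac r).1).
apply/eqP; rewrite !piE /equivf /FracField.mulf.
rewrite !numden_Ratio ?mulf_neq0 ?denom_ratioP ?oner_eq0//.
by rewrite !mulr1 mulrC.
Qed.

Let Qp_fracE x : x = (numer x)%:F / (denom x)%:F.
Proof.
apply: (canRL (mulfK _)); first by rewrite Zp_to_Qp_eq0 denom_neq0.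
apply: Qp_frac_inj; rewrite /numer /denom; set r := repr _.
rewrite -[LHS]/(Qp_frac x * FracField.tofrac (frac r).2).
by rewrite -[in LHS](reprK (Qp_frac x)) piM_denom.
Qed.

Lemma Qp_fracP x : exists a b : Zp, b != 0 /\ x = a%:F / b%:F.
Proof. by exists (numer x), (denom x). Qed.

(* |a / b| = |a| / |b|; that this does not depend on the fraction a / b chosen
   by repr is padic_abs_frac. *)
Definition padic_abs x : rat :=
  Zp_abs (frac (repr (Qp_frac x))).1 / Zp_abs (frac (repr (Qp_frac x))).2.

Lemma padic_abs_frac (a b : Zp) : b != 0 ->
  padic_abs (a%:F / b%:F) = Zp_abs a / Zp_abs b.
Proof.
move=> b0; rewrite /padic_abs -/(numer _) -/(denom _); set x : Qp := a%:F / b%:F.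
have /eqP := Qp_fracE x; rewrite {1}/x eqr_div ?Zp_to_Qp_eq0//.
rewrite -!rmorphM (inj_eq Zp_to_Qp_inj) => /eqP /(congr1 (@Zp_abs p p_pr)).
rewrite !Zp_absM => E; apply/eqP.
by rewrite eqr_div ?Zp_abs_eq0// E mulrC.
Qed.

Lemma padic_abs_ge0 x : 0 <= padic_abs x.
Proof. by rewrite divr_ge0 ?Zp_abs_ge0. Qed.

Lemma padic_abs_eq0 x : (padic_abs x == 0) = (x == 0).
Proof.
have [a [b [b0 ->]]] := Qp_fracP x; rewrite padic_abs_frac//.
by rewrite !mulf_eq0 !invr_eq0 !Zp_abs_eq0 !Zp_to_Qp_eq0.
Qed.

Lemma padic_absM x y : padic_abs (x * y) = padic_abs x * padic_abs y.
Proof.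
have [a [b [b0 ->]]] := Qp_fracP x; have [c [d [d0 ->]]] := Qp_fracP y.
rewrite mulf_div -!rmorphM !padic_abs_frac ?mulf_neq0//.
by rewrite !Zp_absM mulf_div.
Qed.

Lemma padic_absD x y : padic_abs (x + y) <= Num.max (padic_abs x) (padic_abs y).
Proof.
have [a [b [b0 ->]]] := Qp_fracP x; have [c [d [d0 ->]]] := Qp_fracP y.
rewrite addf_div ?Zp_to_Qp_eq0// -!rmorphM -rmorphD !padic_abs_frac ?mulf_neq0//.
have b1 : Zp_abs b != 0 by rewrite Zp_abs_eq0.
have d1 : Zp_abs d != 0 by rewrite Zp_abs_eq0.
have bd_gt0 : 0 < Zp_abs b * Zp_abs d.
  by rewrite lt_neqAle eq_sym mulf_neq0//= mulr_ge0 ?Zp_abs_ge0.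
rewrite Zp_absM ler_pdivrMr// maxr_pMl ?(ltW bd_gt0)//.
rewrite mulrA divfK// [Zp_abs b * _]mulrC mulrA divfK// -!Zp_absM.
exact: Zp_absD.
Qed.

Lemma padic_absN x : padic_abs (- x) = padic_abs x.
Proof.
have [a [b [b0 ->]]] := Qp_fracP x.
by rewrite -mulNr -rmorphN !padic_abs_frac// Zp_absN.
Qed.

Lemma padic_abs0 : padic_abs 0 = 0.
Proof. by apply/eqP; rewrite padic_abs_eq0. Qed.

Lemma padic_absV x : padic_abs x^-1 = (padic_abs x)^-1.
Proof.
have [a [b [b0 ->]]] := Qp_fracP x; rewrite invf_div.
case: (eqVneq a 0) => [->|a0]; last by rewrite !padic_abs_frac// invf_div.
by rewrite rmorph0 invr0 mulr0 mul0r padic_abs0 invr0.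
Qed.

Lemma padic_abs_tofrac (a : Zp) : padic_abs a%:F = Zp_abs a.
Proof.
rewrite -[a%:F]divr1 -(rmorph1 Zp_to_Qp) padic_abs_frac ?oner_neq0//.
by rewrite Zp_abs1 divr1.
Qed.

Lemma padic_abs_p : padic_abs p%:R = p%:R^-1.
Proof. by rewrite -Zp_abs_p -padic_abs_tofrac rmorph_nat. Qed.

Lemma padic_abs_expz x : x != 0 -> exists m : int, padic_abs x = p%:R ^ m.
Proof.
have [a [b [b0 ->]]] := Qp_fracP x.
rewrite mulf_eq0 invr_eq0 !Zp_to_Qp_eq0 (negbTE b0) orbF => a0.
rewrite padic_abs_frac// /Zp_abs (negbTE a0) (negbTE b0) invrK mulrC.
exists ((Zp_val b)%:Z - (Zp_val a)%:Z).
by rewrite expfzDr ?exprnN// pnatr_eq0 -lt0n prime_gt0.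
Qed.

Definition padic_dist x y : rat := padic_abs (x - y).

Fact padic_distxx x : padic_dist x x = 0.
Proof. by rewrite /padic_dist subrr padic_abs0. Qed.
Fact padic_dist_eq0 x y : padic_dist x y = 0 -> x = y.
Proof. by move/eqP; rewrite padic_abs_eq0 subr_eq0 => /eqP. Qed.
Fact padic_dist_sym x y : padic_dist x y = padic_dist y x.
Proof. by rewrite /padic_dist -padic_absN opprB. Qed.
Fact padic_dist_triangle y x z :
  padic_dist x z <= padic_dist x y + padic_dist y z.
Proof.
rewrite /padic_dist -[x - z](subrKA y); apply: le_trans (padic_absD _ _) _.
by rewrite ge_max lerDl lerDr !padic_abs_ge0.
Qed.
HB.instance Definition _ := isMetric.Build rat Qp
  padic_distxx padic_dist_eq0 padic_dist_sym padic_dist_triangle.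

End QpAbs.

Section Sphere.
Variables (p : nat) (p_pr : prime p) (n : nat).
Local Notation Qp := (Qp p_pr).
Implicit Types v : 'cV[Qp]_n.

Definition vnorm v : rat := \big[Num.max/0]_(i < n) padic_abs (v i 0).

Lemma vnormZ (a : Qp) v : vnorm (a *: v) = padic_abs a * vnorm v.
Proof.
rewrite /vnorm (big_morph _ (fun y z => maxr_pMr y z (padic_abs_ge0 a)) (mulr0 _)).
by apply: eq_bigr => i _; rewrite mxE padic_absM.
Qed.

Lemma vnorm0 : vnorm 0 = 0.
Proof. by have := vnormZ 0 0; rewrite scale0r padic_abs0 mul0r. Qed.

Lemma vnorm_neq0 v : v != 0 -> exists i, vnorm v = padic_abs (v i 0) /\ v i 0 != 0.
Proof.
move=> v0.
have /existsP[i0 vi0] : [exists i, v i 0 != 0].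
  rewrite -negb_forall; apply: contra v0 => /forallP v0.
  by apply/eqP/colP => i; rewrite mxE; apply/eqP.
have [|i _ E] := @eq_bigmax _ rat _ 0 i0 predT (fun i => padic_abs (v i 0)) isT.
  by move=> i _; exact: padic_abs_ge0.
exists i; split; first exact: E.
apply: contra vi0 => /eqP vi; rewrite -padic_abs_eq0 eq_le padic_abs_ge0 andbT.
rewrite -[leRHS](@padic_abs0 p p_pr) -vi -E.
exact: (@le_bigmax _ _ _ 0 (fun i => padic_abs (v i 0)) i0).
Qed.

Lemma padic_abs_ratr_expz (m : int) :
  padic_abs (ratr (p%:R ^ m) : Qp) = p%:R ^ (- m).
Proof.
have p0 : p%:R != 0 :> rat by rewrite pnatr_eq0 -lt0n prime_gt0.
have pX k : padic_abs (p%:R ^+ k : Qp) = p%:R ^- k.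
  elim: k => [|k IHk].
    by rewrite !expr0 invr1 -(rmorph1 (@Zp_to_Qp p p_pr)) padic_abs_tofrac Zp_abs1.
  by rewrite !exprS padic_absM IHk padic_abs_p -invfM.
have pk k : (p ^ k)%:Z != 0 by rewrite eqz_nat -lt0n expn_gt0 prime_gt0.
case: m => k.
  by rewrite -exprnP -natrX ratr_nat natrX pX exprnN.
rewrite NegzE opprK -exprnN -exprnP -natrX /ratr.
rewrite -[(p ^ k.+1)%:R]/((p ^ k.+1)%:Z%:~R).
have dE := denqVz (pk k.+1); have nE : numq ((p ^ k.+1)%:Z%:~R^-1) = 1.
  by apply: (@intr_inj rat); rewrite numqE dE /= mulVf// intr_eq0.
rewrite dE nE padic_absM padic_absV ger0_norm//.
by rewrite -!pmulrn !natrX pX invrK (pX 0%N) expr0 invr1 mul1r.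
Qed.

Lemma padic_abs_ratr_vnorm v : v != 0 ->
  padic_abs (ratr (vnorm v) : Qp) = (vnorm v)^-1.
Proof.
case/vnorm_neq0 => i [-> /padic_abs_expz[m ->]].
by rewrite padic_abs_ratr_expz invr_expz.
Qed.

Definition unit_sphere : set 'cV[Qp]_n := [set v | vnorm v = 1].

End Sphere.
Arguments unit_sphere {p} p_pr n.

Section GL.
Variables (p : nat) (p_pr : prime p) (n : nat).
Local Notation Qp := (Qp p_pr).

Record GL := MkGL { GL_mx :> 'M[Qp]_n; GL_unitmx : GL_mx \in unitmx }.

HB.instance Definition _ := [isSub for GL_mx].
HB.instance Definition _ := [Choice of GL by <:].
HB.instance Definition _ := Topological.copy GL (initial_topology GL_mx).

Implicit Types S T : GL.

Fact GL_one_subproof : (1%:M : 'M[Qp]_n) \in unitmx. Proof. exact: unitmx1. Qed.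
Definition GL_one : GL := MkGL GL_one_subproof.
Fact GL_mul_subproof S T : (GL_mx S *m GL_mx T) \in unitmx.
Proof. by rewrite unitmx_mul !GL_unitmx. Qed.
Definition GL_mul S T : GL := MkGL (GL_mul_subproof S T).
Fact GL_inv_subproof S : invmx (GL_mx S) \in unitmx.
Proof. by rewrite unitmx_inv GL_unitmx. Qed.
Definition GL_inv S : GL := MkGL (GL_inv_subproof S).

Fact GL_mulA : associative GL_mul.
Proof. by move=> S T U; apply: val_inj; exact: mulmxA. Qed.
Fact GL_mul1g : left_id GL_one GL_mul.
Proof. by move=> S; apply: val_inj; exact: mul1mx. Qed.
Fact GL_mulg1 : right_id GL_one GL_mul.
Proof. by move=> S; apply: val_inj; exact: mulmx1. Qed.
Fact GL_mulVg : left_inverse GL_one GL_inv GL_mul.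
Proof. by move=> S; apply: val_inj; apply: mulVmx; exact: GL_unitmx. Qed.
Fact GL_mulgV : right_inverse GL_one GL_inv GL_mul.
Proof. by move=> S; apply: val_inj; apply: mulmxV; exact: GL_unitmx. Qed.
HB.instance Definition _ := isGroup.Build GL
  GL_mulA GL_mul1g GL_mulg1 GL_mulVg GL_mulgV.

Fact sphere_bar_subproof T (x : unit_sphere p_pr n) :
  (ratr (vnorm (GL_mx T *m set_val x)) *: (GL_mx T *m set_val x))
    \in unit_sphere p_pr n.
Proof.
apply/mem_set; rewrite /unit_sphere/= vnormZ.
have x0 : set_val x != 0.
  apply/eqP => x0; have := set_valP x; rewrite /unit_sphere/=.
  by rewrite -set_valE x0 vnorm0 => /esym/eqP; rewrite oner_eq0.
have Tx0 : GL_mx T *m set_val x != 0.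
  apply: contra x0 => /eqP /(congr1 (mulmx (invmx (GL_mx T)))).
  by rewrite mulKmx ?GL_unitmx// mulmx0 => ->.
rewrite padic_abs_ratr_vnorm// mulVf//.
by have [i [-> vi0]] := vnorm_neq0 Tx0; rewrite padic_abs_eq0.
Qed.

(* The rational number vnorm v is a power of p when v != 0; ratr sends it to the
   same power of p in Q_p. *)
Definition sphere_bar T (x : unit_sphere p_pr n) : unit_sphere p_pr n :=
  SigSub (sphere_bar_subproof T x).

Definition GL_scalar : set GL :=
  [set T | exists2 b : Qp, b != 0 & GL_mx T = b%:M].

Lemma GL_scalar1 : GL_scalar 1%g.
Proof. by exists 1; rewrite ?oner_neq0. Qed.

Lemma GL_scalarV S : GL_scalar S -> GL_scalar S^-1%g.
Proof. by case=> b b0 E; exists b^-1; rewrite ?invr_eq0//= E invmx_scalar. Qed.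

Lemma GL_scalarM S T : GL_scalar S -> GL_scalar T -> GL_scalar (S * T)%g.
Proof.
case=> b b0 SE [c c0 TE]; exists (b * c); first exact: mulf_neq0.
by rewrite -[LHS]/(GL_mx S *m GL_mx T) SE TE scalar_mxM.
Qed.

Lemma GL_scalarC S T : GL_scalar S -> (S * T = T * S)%g.
Proof. by case=> b _ SE; apply: val_inj => /=; rewrite SE scalar_mxC. Qed.

Definition PGL_rel S T : bool := `[< GL_scalar (S^-1 * T)%g >].

Lemma PGL_rel_equiv : equiv_class_of PGL_rel.
Proof.
split=> [S|S T|T S U]; rewrite /PGL_rel.
- by apply/asboolP; rewrite mulVg; exact: GL_scalar1.
- by apply/asbool_equiv_eq; split=> /GL_scalarV; rewrite invgM invgK.
- move=> /asboolP ST /asboolP TU; apply/asboolP.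
  by have := GL_scalarM ST TU; rewrite mulgA mulgK.
Qed.

Canonical PGL_equiv := EquivRelPack PGL_rel_equiv.

Definition PGL : Type := quotient_topology {eq_quot PGL_rel}%qT.
HB.instance Definition _ := Quotient.on PGL.
HB.instance Definition _ := Topological.on PGL.

Definition PGL_pi (T : GL) : PGL := (\pi_PGL T)%qT.

Lemma PGL_piP S T : PGL_pi S = PGL_pi T <-> GL_scalar (S^-1 * T)%g.
Proof.
split=> [/(@eqmodP _ PGL_equiv) /asboolP//|cST].
by apply/(@eqmodP _ PGL_equiv)/asboolP.
Qed.

Lemma PGL_reprK (x : PGL) : PGL_pi (repr x) = x.
Proof. exact: reprK. Qed.

Definition PGL_one : PGL := PGL_pi 1%g.
Definition PGL_mul (x y : PGL) : PGL := PGL_pi (repr x * repr y)%g.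
Definition PGL_inv (x : PGL) : PGL := PGL_pi (repr x)^-1%g.

Lemma PGL_piM S T : PGL_mul (PGL_pi S) (PGL_pi T) = PGL_pi (S * T)%g.
Proof.
apply/PGL_piP; set S' := repr _; set T' := repr _.
have /PGL_piP cS : PGL_pi S' = PGL_pi S by exact: PGL_reprK.
have /PGL_piP cT : PGL_pi T' = PGL_pi T by exact: PGL_reprK.
suff -> : ((S' * T')^-1 * (S * T) = (S'^-1 * S) * (T'^-1 * T))%g.
  exact: GL_scalarM.
by rewrite invgM -mulgA (mulgA S'^-1)%g (GL_scalarC T cS) (GL_scalarC _ cS) mulgA.
Qed.

Lemma PGL_piV S : PGL_inv (PGL_pi S) = PGL_pi S^-1%g.
Proof.
apply/PGL_piP; set S' := repr _; rewrite invgK.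
have /PGL_piP cS : PGL_pi S' = PGL_pi S by exact: PGL_reprK.
have := GL_scalarV cS; rewrite invgM invgK => cS'.
by rewrite -[S'](mulVKg S) -(GL_scalarC _ cS') mulgK.
Qed.

Fact PGL_mulA : associative PGL_mul.
Proof.
move=> x y z; rewrite -(PGL_reprK x) -(PGL_reprK y) -(PGL_reprK z).
by rewrite !PGL_piM mulgA.
Qed.
Fact PGL_mul1g : left_id PGL_one PGL_mul.
Proof. by move=> x; rewrite -(PGL_reprK x) PGL_piM mul1g. Qed.
Fact PGL_mulg1 : right_id PGL_one PGL_mul.
Proof. by move=> x; rewrite -(PGL_reprK x) PGL_piM mulg1. Qed.
Fact PGL_mulVg : left_inverse PGL_one PGL_inv PGL_mul.
Proof. by move=> x; rewrite -(PGL_reprK x) PGL_piV PGL_piM mulVg. Qed.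
Fact PGL_mulgV : right_inverse PGL_one PGL_inv PGL_mul.
Proof. by move=> x; rewrite -(PGL_reprK x) PGL_piV PGL_piM mulgV. Qed.
HB.instance Definition _ := isGroup.Build PGL
  PGL_mulA PGL_mul1g PGL_mulg1 PGL_mulVg PGL_mulgV.

End GL.
Arguments GL {p} p_pr n.
Arguments GL_scalar {p} p_pr n.
Arguments PGL {p} p_pr n.

Definition is_semigroup (G : groupType) (S : set G) : Prop :=
  S !=set0 /\ forall x y, S x -> S y -> S (x * y)%g.

Definition is_subgroup (G : groupType) (H : set G) : Prop :=
  [/\ H 1%g, forall x y, H x -> H y -> H (x * y)%g &
      forall x, H x -> H x^-1%g].

Definition generated (G : groupType) (S : set G) : set G :=
  smallest (@is_subgroup G) S.

Definition distal (X : topologicalType) (H : set (X -> X)) : Prop :=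
  forall x y : X, x <> y ->
    closure [set (h x, h y) | h in H] `&` diagonal = set0.

Definition distal_on_sphere (p : nat) (p_pr : prime p) (n : nat)
    (S : set (GL p_pr n)) : Prop :=
  distal [set sphere_bar T | T in S].

(* Main.v *)
Require Import Defs.
From mathcomp Require Import all_boot all_order all_algebra generic_quotient.
From mathcomp Require Import all_classical all_reals topology.
From mathcomp Require Import zify.

(** Say that the distortion of a matrix A is at most M when
    |A u| |v| <= M |u| |A v| for all u, v; for invertible A this is the bound
    |A| |A^-1| <= M, and it is invariant under scaling. Distality of S on the
    sphere amounts to a uniform bound on the distortion of the elements of S:
    such a bound keeps the images of x <> y at distance >= |x - y| / M;
    conversely, if the distortion is unbounded on S, the elements of S scaled to
    norm 1 accumulate at a singular matrix A of norm 1, and elements of S bring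
    x and x + p w arbitrarily close when A x <> 0 and A w = 0.

    A uniform bound also amounts to condition (iii). Scaled to norm 1, the
    matrices of distortion at most M form a compact subset of GL_n, so the closure
    C of the image of S in PGL_n is compact, and it is a group because the powers
    of an element accumulate in C. Conversely the distortion is locally bounded on
    PGL_n, hence bounded on a compact C; if C is moreover a group, the bound holds
    on the group generated by S. *)

Set Implicit Arguments.
Unset Strict Implicit.
Unset Printing Implicit Defensive.

Import Order.TTheory GRing.Theory Num.Theory.

Local Open Scope classical_set_scope.
Local Open Scope ring_scope.

(** * The ultrametric maximum norm on p-adic matrices *)

Section MxNorm.
Variables (p : nat) (p_pr : prime p).
Local Notation Qp := (Qp p_pr).

Definition mxnorm m n (A : 'M[Qp]_(m, n)) : rat :=
  \big[Num.max/0]_(ij : 'I_m * 'I_n) padic_abs (A ij.1 ij.2).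

Lemma mxnorm_le m n (A : 'M[Qp]_(m, n)) c : 0 <= c ->
  (forall i j, padic_abs (A i j) <= c) -> mxnorm A <= c.
Proof. by move=> c0 Ac; apply/bigmax_leP; split=> // ij _. Qed.

Lemma mxnorm_ltP m n (A : 'M[Qp]_(m, n)) c : 0 < c ->
  mxnorm A < c <-> forall i j, padic_abs (A i j) < c.
Proof.
move=> c0; split=> [/bigmax_ltP[_ Ac] i j|Ac]; first exact: (Ac (i, j)).
by apply/bigmax_ltP; split=> // ij _.
Qed.

Lemma mxnorm_ge0 m n (A : 'M[Qp]_(m, n)) : 0 <= mxnorm A.
Proof. exact: bigmax_ge_id. Qed.

Lemma padic_abs_le_mxnorm m n (A : 'M[Qp]_(m, n)) i j :
  padic_abs (A i j) <= mxnorm A.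
Proof.
exact: (@le_bigmax _ _ _ 0 (fun ij : 'I_m * 'I_n => padic_abs (A ij.1 ij.2)) (i, j)).
Qed.

Lemma mxnorm_eq0 m n (A : 'M[Qp]_(m, n)) : (mxnorm A == 0) = (A == 0).
Proof.
apply/idP/eqP => [/eqP A0|->].
  apply/matrixP => i j; rewrite mxE; apply/eqP.
  by rewrite -padic_abs_eq0 eq_le padic_abs_ge0 andbT -A0 padic_abs_le_mxnorm.
rewrite eq_le mxnorm_ge0 andbT; apply: mxnorm_le => // i j.
by rewrite mxE padic_abs0.
Qed.

Lemma mxnorm0 m n : mxnorm (0 : 'M[Qp]_(m, n)) = 0.
Proof. by apply/eqP; rewrite mxnorm_eq0. Qed.

Lemma mxnorm_gt0 m n (A : 'M[Qp]_(m, n)) : (0 < mxnorm A) = (A != 0).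
Proof. by rewrite lt_def mxnorm_ge0 andbT mxnorm_eq0. Qed.

Lemma vnormE n (v : 'cV[Qp]_n) : vnorm v = mxnorm v.
Proof.
apply/le_anti/andP; split.
  apply/bigmax_leP; split=> [|i _]; first exact: mxnorm_ge0.
  exact: padic_abs_le_mxnorm.
apply: mxnorm_le => [|i j]; first exact: bigmax_ge_id.
rewrite ord1.
exact: (@le_bigmax _ _ _ 0 (fun i => padic_abs (v i 0)) i).
Qed.

Lemma mxnormN m n (A : 'M[Qp]_(m, n)) : mxnorm (- A) = mxnorm A.
Proof. by apply: eq_bigr => ij _; rewrite mxE padic_absN. Qed.

Lemma mxnormB_sym m n (A B : 'M[Qp]_(m, n)) : mxnorm (A - B) = mxnorm (B - A).
Proof. by rewrite -mxnormN opprB. Qed.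

Lemma mxnormZ m n a (A : 'M[Qp]_(m, n)) :
  mxnorm (a *: A) = padic_abs a * mxnorm A.
Proof.
rewrite /mxnorm (big_morph _ (fun y z => maxr_pMr y z (padic_abs_ge0 a)) (mulr0 _)).
by apply: eq_bigr => ij _; rewrite mxE padic_absM.
Qed.

Lemma mxnormD m n (A B : 'M[Qp]_(m, n)) :
  mxnorm (A + B) <= Num.max (mxnorm A) (mxnorm B).
Proof.
apply: mxnorm_le => [|i j]; first by rewrite le_max mxnorm_ge0.
rewrite mxE (le_trans (padic_absD _ _))// ge_max !le_max.
by rewrite !padic_abs_le_mxnorm orbT.
Qed.

(** Otherwise [A], as the difference of [A + B] and [B], would have norm below its own: in an
    ultrametric a strictly larger term decides the norm. *)
Lemma mxnormD_dominant m n (A B : 'M[Qp]_(m, n)) :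
  mxnorm B < mxnorm A -> mxnorm (A + B) = mxnorm A.
Proof.
move=> BA; apply/le_anti/andP; split.
  by rewrite (le_trans (mxnormD _ _))// max_l// ltW.
rewrite leNgt; apply/negP => ABA.
have := mxnormD (A + B) (- B); rewrite addrK mxnormN leNgt gt_max.
by rewrite ABA BA.
Qed.

Lemma padic_abs_sum I (r : seq I) (F : I -> Qp) c : 0 <= c ->
  (forall i, padic_abs (F i) <= c) -> padic_abs (\sum_(i <- r) F i) <= c.
Proof.
move=> c0 Fc; apply: (big_ind (fun x : Qp => padic_abs x <= c)) => //.
  by rewrite padic_abs0.
by move=> x y xc yc; rewrite (le_trans (padic_absD _ _))// ge_max xc.
Qed.

(** An ultrametric sum is at most its largest term, so no factor [n] appears. *)
Lemma mxnormM m n k (A : 'M[Qp]_(m, n)) (B : 'M[Qp]_(n, k)) :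
  mxnorm (A *m B) <= mxnorm A * mxnorm B.
Proof.
have AB0 : 0 <= mxnorm A * mxnorm B by rewrite mulr_ge0 ?mxnorm_ge0.
apply: mxnorm_le => // i j; rewrite mxE padic_abs_sum// => l.
by rewrite padic_absM ler_pM ?padic_abs_ge0 ?padic_abs_le_mxnorm.
Qed.

Lemma padic_abs1 : padic_abs (1 : Qp) = 1.
Proof. by rewrite -(rmorph1 (@Zp_to_Qp p p_pr)) padic_abs_tofrac Zp_abs1. Qed.

(** The maximum is attained at an entry, whose inverse is the required scalar. *)
Lemma mxnorm_normalize m n (A : 'M[Qp]_(m, n)) : A != 0 ->
  exists2 c : Qp, c != 0 & mxnorm (c *: A) = 1.
Proof.
move=> A0.
have /existsP[[i0 j0]] : [exists ij, A ij.1 ij.2 != 0].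
  rewrite -negb_forall; apply: contra A0 => /forallP A0.
  by apply/eqP/matrixP => i j; rewrite mxE; apply/eqP; have := A0 (i, j).
move=> A00; have [|[i j] _ E] :=
  @eq_bigmax _ rat _ 0 (i0, j0) predT (fun ij => padic_abs (A ij.1 ij.2)) isT.
  by move=> ij _; exact: padic_abs_ge0.
have Aij0 : A i j != 0 by rewrite -padic_abs_eq0 -[padic_abs _]E -/(mxnorm A) mxnorm_eq0.
exists (A i j)^-1; first by rewrite invr_eq0.
by rewrite mxnormZ [X in _ * X]E -padic_absM mulVf ?padic_abs1.
Qed.

Lemma nbhs_mxnormP m n (A : 'M[Qp]_(m, n)) (U : set 'M[Qp]_(m, n)) :
  nbhs A U <-> exists2 e : rat, 0 < e & forall B, mxnorm (B - A) < e -> U B.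
Proof.
rewrite -nbhs_ballE; split=> -[e /= e0 eU]; exists e => // B.
- move/(mxnorm_ltP _ e0) => BA; apply: eU; split=> // i j.
  have := BA i j; rewrite !mxE => BAij.
  by rewrite ballEmdist /= -[mdist _ _]padic_absN opprB.
- move=> [_ BA]; apply: eU; apply/(mxnorm_ltP _ e0) => i j.
  have := BA i j; rewrite ballEmdist /= -[mdist _ _]padic_absN opprB.
  by rewrite !mxE.
Qed.

End MxNorm.

(** * Compactness of the unit ball of p-adic matrices *)

Section Compactness.
Variables (p : nat) (p_pr : prime p).
Local Notation Qp := (Qp p_pr).

Let p_gt0 : 0 < p%:R :> rat.
Proof. by rewrite ltr0n prime_gt0. Qed.

Let pX_gt0 k : 0 < p%:R ^+ k :> rat.
Proof. exact: exprn_gt0. Qed.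

Lemma expr_inv_lt (e : rat) : 0 < e -> exists k, p%:R ^- k < e.
Proof.
move=> e0; exists (Num.bound e^-1).
rewrite -[ltRHS]invrK ltf_pV2 ?posrE ?invr_gt0//.
apply: lt_trans (archi_boundP _) _; first by rewrite invr_ge0 ltW.
by rewrite -natrX ltr_nat ltn_expl// prime_gt1.
Qed.

Lemma Zp_abs_sub_le (a b : Defs.Zp p_pr) k :
  (Zp_abs (a - b) <= p%:R ^- k) = (a k == b k).
Proof.
rewrite Zp_abs_le; apply/eqP/eqP => [ab|ab].
  by rewrite -[a](subrK b) Zp_resD ab add0n Zp_modE.
rewrite Zp_resD ab /= modnDmr subnKC ?modnn//.
by rewrite -(Zp_modE b k) ltnW// ltn_mod expn_gt0 prime_gt0.
Qed.

(** Write [x = a / b] and divide both by the power of p in [b]: the new denominator [b'] is prime to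
    p, so [m * b' = a'] can be solved modulo [p ^ k]. *)
Lemma padic_integer_approx (x : Qp) k : padic_abs x <= 1 ->
  exists2 m, (m < p ^ k)%N & padic_abs (x - m%:R) <= p%:R ^- k.
Proof.
have [a [b [b0 ->]]] := Qp_fracP x; rewrite padic_abs_frac// => ab.
have bgt0 : 0 < Zp_abs b by rewrite lt_def Zp_abs_eq0 b0 Zp_abs_ge0.
move: ab; rewrite ler_pdivrMr// mul1r.
have bE : Zp_abs b = p%:R ^- Zp_val b by rewrite /Zp_abs (negbTE b0).
set v := Zp_val b in bE *; rewrite bE Zp_abs_le => /eqP av.
have bv : b v = 0%N by apply/eqP; rewrite -Zp_abs_le bE.
have bv1 : b v.+1 != 0%N.
  by rewrite Zp_valP ?ltnn//; exact/eqP.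
(* One digit beyond [v + k], so that [b'] is seen to be prime to p even when [k = 0]. *)
set K := (v + k.+1)%N.
have vK : (v <= K)%N by rewrite leq_addr.
have pv0 : (0 < p ^ v)%N by rewrite expn_gt0 prime_gt0.
have /dvdnP[a' aE] : (p ^ v %| a K)%N by rewrite /dvdn Zp_res_mod// av.
have /dvdnP[b' b'E] : (p ^ v %| b K)%N by rewrite /dvdn Zp_res_mod// bv.
have cop : coprime (p ^ k.+1) b'.
  apply: coprimeXl; rewrite prime_coprime//; apply: contra bv1 => /dvdnP[c cE].
  have vK1 : (v.+1 <= K)%N by rewrite /K addnS ltnS leq_addr.
  by rewrite -(Zp_res_mod b vK1) b'E cE -mulnA -expnS modnMl.
(* This number is [a'] modulo [p ^ k.+1] and a multiple of [b']; its quotient [m0] solves the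
   congruence. *)
have /dvdnP[m0 m0E] : (b' %| chinese (p ^ k.+1) b' a' 0)%N.
  by rewrite /dvdn chinese_modr// mod0n.
have := chinese_modl cop a' 0; rewrite m0E => m0P.
exists (m0 %% p ^ k)%N; first by rewrite ltn_mod expn_gt0 prime_gt0.
have bF0 : Zp_to_Qp b != 0 by rewrite Zp_to_Qp_eq0.
rewrite -{1}(mulfK bF0 (_ %:R)) -mulrBl -(rmorph_nat (@Zp_to_Qp p p_pr)).
rewrite -rmorphM -rmorphB padic_abs_frac// ler_pdivrMr// bE -invfM -exprD addnC.
rewrite Zp_abs_sub_le Zp_resM Zp_res_nat.
have vkK : (v + k <= K)%N by rewrite /K addnS.
rewrite -(Zp_res_mod a vkK) -(Zp_res_mod b vkK) aE b'E modnMm; apply/eqP.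
rewrite expnD [(p ^ v * _)%N]mulnC mulnA -!muln_modl; congr (_ * _)%N.
have : (m0 * b' %% p ^ k = a' %% p ^ k)%N.
  have := congr1 (modn^~ (p ^ k)%N) m0P.
  by rewrite !modn_dvdm// dvdn_exp2l.
by move=> <-; rewrite modnMml.
Qed.

(** Otherwise [F] contains the complements of the [N] sets, whose intersection misses [A]. *)
Lemma ultra_finite_cover T (F : set_system T) (UF : UltraFilter F) N
    (A : set T) (B : nat -> set T) :
  F A -> (forall t, A t -> exists2 m, (m < N)%N & B m t) ->
  exists2 m, (m < N)%N & F (B m).
Proof.
move=> FA AB; apply: contrapT => nB.
have FB (m : 'I_N) : F (~` B m).
  have [FBm|//] := in_ultra_setVsetC (B m) UF.
  by exfalso; apply: nB; exists m.
have FnB : F [set t | forall m : 'I_N, ~ B m t] by exact: filter_forall.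
have [t [At nBt]] := filter_ex (filterI FA FnB).
by have [m mN Bmt] := AB t At; exact: (nBt (Ordinal mN)).
Qed.

Lemma padic_abs_ultra_sub (x y z : Qp) c :
  padic_abs (x - y) <= c -> padic_abs (x - z) <= c -> padic_abs (y - z) <= c.
Proof.
move=> xy xz; rewrite -(subrKA x) (le_trans (padic_absD _ _))// ge_max xz.
by rewrite -padic_absN opprB xy.
Qed.

(** For each [k] the ultrafilter selects one of the [p ^ k] residue classes; these are compatible,
    and Z_p, being an inverse limit, contains the element they define. *)
Lemma padic_integer_ultra_limit T (F : set_system T) (UF : UltraFilter F)
    (f : T -> Qp) : F [set t | padic_abs (f t) <= 1] ->
  exists x, forall k, F [set t | padic_abs (f t - x) <= p%:R ^- k].
Proof.
move=> Ff.
have /choice[m mP] k : exists m, F [set t | padic_abs (f t - m%:R) <= p%:R ^- k].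
  have [|m _] := ultra_finite_cover UF (N := (p ^ k)%N)
    (B := fun m => [set t | padic_abs (f t - m%:R) <= p%:R ^- k]) Ff; last by exists m.
  by move=> t; exact: padic_integer_approx.
have pow_le k : p%:R ^- k.+1 <= p%:R ^- k :> rat.
  by rewrite lef_pV2 ?posrE// ler_eXn2l// ltr1n prime_gt1.
have mE k : m k.+1 = m k %[mod p ^ k].
  have [t [/= t1 t0]] := filter_ex (filterI (mP k.+1) (mP k)).
  have := padic_abs_ultra_sub (le_trans t1 (pow_le k)) t0.
  rewrite -!(rmorph_nat (@Zp_to_Qp p p_pr)) -rmorphB padic_abs_tofrac.
  by rewrite Zp_abs_sub_le !Zp_res_nat => /eqP.
exists (Zp_to_Qp (Zp_mk p_pr mE)) => k; apply: filterS (mP k) => t /= tm.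
apply: (@padic_abs_ultra_sub (m k)%:R); rewrite -padic_absN opprB//.
rewrite -(rmorph_nat (@Zp_to_Qp p p_pr)) -rmorphB padic_abs_tofrac.
by rewrite Zp_abs_sub_le Zp_res_nat.
Qed.

Lemma compact_mxnorm_le1 m n : compact [set A : 'M[Qp]_(m, n) | mxnorm A <= 1].
Proof.
rewrite compact_ultra => F UF F1.
have /choice[A AP] (ij : 'I_m * 'I_n) : exists x, forall k,
    F [set B : 'M[Qp]_(m, n) | padic_abs (B ij.1 ij.2 - x) <= p%:R ^- k].
  apply: padic_integer_ultra_limit; apply: filterS F1 => B /= B1.
  by rewrite (le_trans (padic_abs_le_mxnorm _ _ _)).
pose L : 'M[Qp]_(m, n) := \matrix_(i, j) A (i, j).
have FL e : 0 < e -> F [set B | mxnorm (B - L) < e].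
  move=> e0; have [k ke] := expr_inv_lt e0.
  have : F [set B | forall ij : 'I_m * 'I_n,
      padic_abs (B ij.1 ij.2 - A ij) <= p%:R ^- k].
    by apply: filter_forall => ij; exact: AP.
  apply: filterS => B BA.
  apply: le_lt_trans ke; apply: mxnorm_le => [|i j].
    by rewrite invr_ge0 ltW.
  by rewrite !mxE; exact: (BA (i, j)).
exists L; split=> /=; last first.
  by move=> U /nbhs_mxnormP[e /FL FLe eU]; exact: filterS FLe.
have [B [/= B1 BL]] := filter_ex (filterI F1 (FL 1 ltr01)).
rewrite -[L](subrK B) (le_trans (mxnormD _ _))// ge_max B1 andbT.
by rewrite mxnormB_sym ltW.
Qed.

End Compactness.

(** Stands in for the extraction of a convergent subsequence. *)
Lemma compact_seq_cluster (T : topologicalType) (A : set T) (u : nat -> T) :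
  compact A -> (forall k, A (u k)) ->
  exists2 x, A x & forall U, nbhs x U -> forall N, exists2 k, (N <= k)%N & U (u k).
Proof.
move=> cA Au; have FA : (u @ \oo) A by exists 0%N => // k _; exact: Au.
have [x [Ax clx]] := cA _ _ FA; exists x => // U Ux N.
have FN : (u @ \oo) (u @` [set k | (N <= k)%N]).
  by exists N => // k /= Nk; exists k.
by have [_ [[k Nk <-] Uk]] := clx _ _ FN Ux; exists k.
Qed.

(** * Matrices of bounded distortion *)

Section Distortion.
Variables (p : nat) (p_pr : prime p) (n : nat).
Local Notation Qp := (Qp p_pr).
Implicit Types (A B : 'M[Qp]_n) (u v w : 'cV[Qp]_n) (M : rat).

(* For invertible A the least such M is the condition number |A| |A^-1|. *)
Definition distortion_le M A := forall u v : 'cV[Qp]_n,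
  mxnorm (A *m u) * mxnorm v <= M * (mxnorm u * mxnorm (A *m v)).

Lemma distortion_leW M M' A : M <= M' -> distortion_le M A -> distortion_le M' A.
Proof.
move=> MM' AM u v; apply: le_trans (AM u v) _.
by rewrite ler_wpM2r// mulr_ge0 ?mxnorm_ge0.
Qed.

Lemma distortion_leZ M c A : distortion_le M A -> distortion_le M (c *: A).
Proof.
move=> AM u v; rewrite -!scalemxAl !mxnormZ -mulrA.
rewrite [X in M * X]mulrCA [X in _ <= X]mulrCA.
by rewrite ler_wpM2l ?padic_abs_ge0.
Qed.

Lemma distortion_le_condition_number A : A \in unitmx ->
  distortion_le (mxnorm A * mxnorm (invmx A)) A.
Proof.
move=> Au u v; rewrite mulrACA ler_pM ?mxnorm_ge0 ?mxnormM//.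
by rewrite -{1}(mulKmx Au v) mxnormM.
Qed.

Lemma mxnorm_mul_near A B u :
  mxnorm (B - A) * mxnorm u < mxnorm (A *m u) ->
  mxnorm (B *m u) = mxnorm (A *m u).
Proof.
move=> BA; rewrite -{1}(subrK A B) mulmxDl addrC mxnormD_dominant//.
exact: le_lt_trans (mxnormM _ _) BA.
Qed.

(** For [B] near [A], |B u| = |A u| holds for every [u] at once, since |u| <= |A^-1| |A u|; the two
    distortion inequalities then coincide. *)
Lemma distortion_le_near M A : A \in unitmx ->
  exists2 e : rat, 0 < e & forall B, mxnorm (B - A) < e ->
    distortion_le M B <-> distortion_le M A.
Proof.
move=> Au; set N := mxnorm (invmx A); have N0 : 0 <= N := mxnorm_ge0 _.
have N1 : 0 < N + 1 by rewrite ltr_wpDl.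
(* This gives |B - A| |A^-1| < 1; the added 1 makes the denominator positive. *)
exists (N + 1)^-1; first by rewrite invr_gt0.
move=> B BA; suff E u : mxnorm (B *m u) = mxnorm (A *m u).
  by split=> H u v; have := H u v; rewrite !E.
have [->|u0] := eqVneq u 0; first by rewrite !mulmx0.
have Au0 : 0 < mxnorm (A *m u).
  rewrite mxnorm_gt0; apply: contra u0 => /eqP Au0.
  by rewrite -(mulKmx Au u) Au0 mulmx0.
apply: mxnorm_mul_near; apply: (@le_lt_trans _ _ (mxnorm (B - A) * (N * mxnorm (A *m u)))).
  by rewrite ler_wpM2l ?mxnorm_ge0// -{1}(mulKmx Au u) mxnormM.
rewrite mulrA gtr_pMl//.
move: BA; rewrite -div1r ltr_pdivlMr//; apply: le_lt_trans.
by rewrite ler_wpM2l ?mxnorm_ge0// lerDl.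
Qed.

(** As [A] may be singular, [u] and [v] are fixed first: if A u <> 0, then |B u| = |A u| for [B]
    near [A], while |B v| exceeds |A v| by at most |B - A| |v|. *)
Lemma distortion_le_limit M A : 0 <= M ->
  (forall e : rat, 0 < e -> exists2 B, mxnorm (B - A) < e & distortion_le M B) ->
  distortion_le M A.
Proof.
move=> M0 AM u v.
have [->|Au0] := eqVneq (A *m u) 0.
  by rewrite mxnorm0 mul0r !mulr_ge0 ?mxnorm_ge0.
have u0 : 0 < mxnorm u.
  by rewrite mxnorm_gt0; apply: contra Au0 => /eqP ->; rewrite mulmx0.
apply/ler_addgt0Pr => e e0.
set c := M * (mxnorm u * mxnorm v).
have c0 : 0 <= c by rewrite !mulr_ge0 ?mxnorm_ge0.
have c1 : 0 < c + 1 by rewrite ltr_wpDl.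
(* The first radius forces |B u| = |A u|; the second keeps the error |B - A| c below [e]. *)
have [|B] := AM (Num.min (mxnorm (A *m u) / mxnorm u) (e / (c + 1))).
  by rewrite lt_min !divr_gt0// mxnorm_gt0.
rewrite lt_min ltr_pdivlMr// ltr_pdivlMr// => /andP[BAu BAe] BM.
rewrite -(mxnorm_mul_near BAu); apply: le_trans (BM u v) _.
have Bv : mxnorm (B *m v) <= mxnorm (A *m v) + mxnorm (B - A) * mxnorm v.
  rewrite -{1}(subrK A B) mulmxDl (le_trans (mxnormD _ _))// ge_max.
  by rewrite ler_wpDl ?mxnorm_ge0 ?mxnormM//= lerDl mulr_ge0 ?mxnorm_ge0.
apply: (@le_trans _ _ (M * (mxnorm u * (mxnorm (A *m v) + mxnorm (B - A) * mxnorm v)))).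
  by apply: ler_wpM2l => //; apply: ler_wpM2l => //; exact: ltW.
rewrite !mulrDr lerD2l.
rewrite (_ : M * _ = mxnorm (B - A) * c); last first.
  by rewrite [in RHS]mulrCA; congr (M * _); rewrite mulrCA.
apply: le_trans (ltW BAe).
by rewrite ler_wpM2l ?mxnorm_ge0// lerDl.
Qed.

Lemma exists_col_neq0 A : A != 0 -> exists j, A *m (delta_mx j 0 : 'cV[Qp]_n) != 0.
Proof.
move=> A0; apply/existsP; rewrite -negb_forall; apply: contra A0 => /forallP A0.
apply/eqP/matrixP => i j; have /eqP := A0 j.
by rewrite -colE => /matrixP/(_ i 0); rewrite !mxE.
Qed.

Lemma not_unitmx_ker A : A \notin unitmx -> exists2 v : 'cV[Qp]_n, v != 0 & A *m v = 0.
Proof.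
rewrite -(unitmx_tr A) -row_free_unit -(kermx_eq0 A^T).
case/rowV0Pn => w wA w0; have {}wA := sub_kermxP wA.
exists w^T; first by rewrite -trmx0 (inj_eq trmx_inj).
by rewrite -[A]trmxK -trmx_mul wA trmx0.
Qed.

(** A nonzero kernel vector [v] and a vector [u] not killed by [A] would violate the inequality.
    Hence limits of normalized matrices of bounded distortion stay invertible. *)
Lemma distortion_le_unitmx M A : A != 0 -> distortion_le M A -> A \in unitmx.
Proof.
move=> /exists_col_neq0[j Aj] AM; apply: contraT => /not_unitmx_ker[v v0 Av].
have := AM (delta_mx j 0) v; rewrite Av mxnorm0 !mulr0 leNgt.
by rewrite mulr_gt0// mxnorm_gt0.
Qed.

Lemma mxnorm_delta i : mxnorm (delta_mx i 0 : 'cV[Qp]_n) = 1.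
Proof.
apply/le_anti/andP; split.
  apply: mxnorm_le => // k l; rewrite mxE.
  by case: (_ && _); rewrite ?padic_abs1 ?padic_abs0.
have := padic_abs_le_mxnorm (delta_mx i 0 : 'cV[Qp]_n) i 0.
by rewrite mxE !eqxx padic_abs1.
Qed.

Lemma mxnorm_col_le m k (B : 'M[Qp]_(m, k)) j : mxnorm (col j B) <= mxnorm B.
Proof.
apply: mxnorm_le => [|i l]; first exact: mxnorm_ge0.
by rewrite mxE padic_abs_le_mxnorm.
Qed.

(** The norm of a matrix is the largest norm of its columns, so the inequality is applied to basis
    vectors and columns of [B]. This allows cancelling a left factor in estimates. *)
Lemma distortion_le_mulmx M A k (B : 'M[Qp]_(n, k)) : 0 <= M ->
  distortion_le M A -> mxnorm A * mxnorm B <= M * mxnorm (A *m B).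
Proof.
move=> M0 AM.
have [->|B0] := eqVneq B 0; first by rewrite mulmx0 mxnorm0 !mulr0.
have Mv j : mxnorm A * mxnorm (col j B) <= M * mxnorm (A *m B).
  have [->|v0] := eqVneq (col j B) 0.
    by rewrite mxnorm0 mulr0 mulr_ge0 ?mxnorm_ge0.
  rewrite -ler_pdivlMr ?mxnorm_gt0//; apply: mxnorm_le => [|i l].
    by rewrite divr_ge0 ?mulr_ge0 ?mxnorm_ge0.
  rewrite ler_pdivlMr ?mxnorm_gt0//.
  apply: (@le_trans _ _ (mxnorm (A *m (delta_mx l 0 : 'cV[Qp]_n)) * mxnorm (col j B))).
    rewrite ler_wpM2r ?mxnorm_ge0//.
    by have := padic_abs_le_mxnorm (A *m (delta_mx l 0 : 'cV_n)) i 0; rewrite -colE mxE.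
  apply: le_trans (AM _ _) _; rewrite mxnorm_delta mul1r ler_wpM2l//.
  by rewrite !colE mulmxA -colE mxnorm_col_le.
have [->|A0] := eqVneq A 0.
  by rewrite mul0mx !mxnorm0 mul0r mulr0.
rewrite mulrC -ler_pdivlMr ?mxnorm_gt0//; apply: mxnorm_le => [|i j].
  by rewrite divr_ge0 ?mulr_ge0 ?mxnorm_ge0.
rewrite ler_pdivlMr ?mxnorm_gt0// mulrC; apply: le_trans (Mv j).
rewrite ler_wpM2l ?mxnorm_ge0//.
by have := padic_abs_le_mxnorm (col j B) i 0; rewrite mxE.
Qed.

Lemma mxnorm_eq1_near m k (A B : 'M[Qp]_(m, k)) :
  mxnorm B = 1 -> mxnorm (B - A) < 1 -> mxnorm A = 1.
Proof.
by move=> B1 BA; rewrite -[A](subrK B) addrC mxnormD_dominant ?B1// mxnormB_sym.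
Qed.

(** Norm 1 and the distortion bound both pass to limits, so the set is closed in the compact unit
    ball. *)
Lemma compact_distortion_le M : 0 <= M ->
  compact [set A : 'M[Qp]_n | mxnorm A = 1 /\ distortion_le M A].
Proof.
move=> M0; apply: subclosed_compact (@compact_mxnorm_le1 p p_pr n n) _; last first.
  by move=> A [/= -> _].
move=> A clA.
have near e : 0 < e -> exists2 B : 'M[Qp]_n, mxnorm (B - A) < e &
    mxnorm B = 1 /\ distortion_le M B.
  move=> e0; have [|B [[B1 BM] Be]] := clA [set B | mxnorm (B - A) < e].
    by apply/nbhs_mxnormP; exists e.
  by exists B.
split.
  by have [B BA [B1 _]] := near 1 ltr01; exact: mxnorm_eq1_near BA.
by apply: distortion_le_limit => // e /near[B BA [_ BM]]; exists B.
Qed.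

End Distortion.

Lemma nbhs_initialP (S : choiceType) (T : topologicalType) (f : S -> T)
    (x : initial_topology f) (U : set S) :
  nbhs x (U : set (initial_topology f)) <->
  exists2 V, nbhs (f x) V & forall y, V (f y) -> U y.
Proof.
split=> [|[V fxV VU]].
  rewrite nbhsE => -[_ [[V Vop <-] Vx] VU].
  by exists V; [exists V|move=> y; exact: VU].
have fV : nbhs x (f @^-1` V) by exact: (@initial_continuous S T f x V fxV).
by move: fV; apply: (@filterS _ (nbhs x)) => y; exact: VU.
Qed.

(** * Metric form of the topologies of GL_n and the sphere, and of distality *)

Section Sphere.
Variables (p : nat) (p_pr : prime p) (n : nat).
Local Notation Qp := (Qp p_pr).
Local Notation sphere := (unit_sphere p_pr n).
Local Notation GL := (GL p_pr n).
Implicit Types (x y d : sphere) (T : GL).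

Lemma nbhs_GLP T (U : set GL) : nbhs T U <->
  exists2 e : rat, 0 < e & forall T', mxnorm (GL_mx T' - GL_mx T) < e -> U T'.
Proof.
split=> [/(@nbhs_initialP _ _ (@GL_mx p p_pr n))|].
  by case=> V /nbhs_mxnormP[e e0 eV] VU; exists e => // T' /eV; exact: VU.
case=> e e0 eU; apply/(@nbhs_initialP _ _ (@GL_mx p p_pr n)).
exists [set B | mxnorm (B - GL_mx T) < e] => //.
by apply/nbhs_mxnormP; exists e.
Qed.

Lemma nbhs_sphereP x (U : set sphere) : nbhs x U <->
  exists2 e : rat, 0 < e & forall y, mxnorm (set_val y - set_val x) < e -> U y.
Proof.
split=> [/(@nbhs_initialP _ _ (@set_val _ sphere))|].
  by case=> V /nbhs_mxnormP[e e0 eV] VU; exists e => // T' /eV; exact: VU.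
case=> e e0 eU; apply/(@nbhs_initialP _ _ (@set_val _ sphere)).
exists [set B | mxnorm (B - set_val x) < e] => //.
by apply/nbhs_mxnormP; exists e.
Qed.

Lemma mxnorm_sphere x : mxnorm (set_val x) = 1.
Proof. by rewrite -vnormE; have := set_valP x. Qed.

Lemma sphere_mk (v : 'cV[Qp]_n) : mxnorm v = 1 -> exists x : sphere, set_val x = v.
Proof.
move=> v1; have vS : v \in sphere by apply/mem_set; rewrite /unit_sphere/= vnormE.
by exists (SigSub vS); rewrite set_valE.
Qed.

(** If some [T k] in [S] bring the images of [x] and [y] within [p ^ -k], a cluster point [d] of the
    images of [x] also serves for [y], and the pair of [d] with itself lies in the closure. *)
Lemma distal_on_sphereP (S : set GL) : distal_on_sphere S <->
  forall x y, x <> y -> exists2 e : rat, 0 < e & forall T, S T ->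
    e <= mxnorm (set_val (sphere_bar T x) - set_val (sphere_bar T y)).
Proof.
split=> [dS x y xy|dS x y xy]; last first.
  apply/seteqP; split=> // -[a b] [clab /= ab].
  have {}ab : a = b by move: ab => /diagonalP.
  subst b.
  have [e e0 eS] := dS x y xy.
  pose U : set sphere := [set b | mxnorm (set_val b - set_val a) < e].
  have aU : nbhs a U by apply/nbhs_sphereP; exists e.
  have [|_ [[_ [T ST <-] <-] /= [Ux Uy]]] := clab (U `*` U).
    by exists (U, U).
  have := eS T ST; rewrite leNgt -(subrKA (set_val a)) => /negP; apply.
  apply: le_lt_trans (mxnormD _ _) _; rewrite gt_max Ux /=.
  by rewrite mxnormB_sym; exact: Uy.
apply: contrapT => /forall2NP nS.
have /choice[T TP] k : exists T, S T /\
    mxnorm (set_val (sphere_bar T x) - set_val (sphere_bar T y)) < p%:R ^- k.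
  have [/negP[]|] := nS (p%:R ^- k).
    by rewrite invr_gt0 exprn_gt0// ltr0n prime_gt0.
  by move=> /existsNP[T /not_implyP[ST /negP]]; rewrite -ltNge => TS; exists T.
have [|d _ dP] := @compact_seq_cluster _ _ (fun k => set_val (sphere_bar (T k) x))
  (@compact_mxnorm_le1 p p_pr n 1).
  by move=> k /=; rewrite mxnorm_sphere.
have near e N : 0 < e -> exists2 k, (N <= k)%N &
    mxnorm (set_val (sphere_bar (T k) x) - d) < e.
  by move=> e0; apply: (dP [set v | mxnorm (v - d) < e]); apply/nbhs_mxnormP; exists e.
(* The cluster point was found in the unit ball; it has norm 1, being at distance below 1 from a
   unit vector. *)
have [a aE] : exists a : sphere, set_val a = d.
  apply: sphere_mk; have [k _] := near 1 0%N ltr01.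
  by apply: mxnorm_eq1_near; exact: mxnorm_sphere.
subst d; have := dS x y xy; apply/eqP/set0P; exists (a, a); split; last first.
  exact/diagonalP.
move=> W [[U1 U2] /= [/nbhs_sphereP[e1 e10 eU1] /nbhs_sphereP[e2 e20 eU2]] UW].
have [N pN] := expr_inv_lt p_pr e20.
have [|k Nk] := near (Num.min e1 e2) N; first by rewrite lt_min e10.
rewrite lt_min => /andP[xe1 xe2].
exists (sphere_bar (T k) x, sphere_bar (T k) y); split.
  by exists (sphere_bar (T k)) => //; exists (T k) => //; exact: (TP k).1.
apply: UW; split=> /=; first exact: eU1.
apply: eU2; rewrite -(subrKA (set_val (sphere_bar (T k) x))).
apply: le_lt_trans (mxnormD _ _) _; rewrite gt_max xe2 andbT mxnormB_sym.
apply: lt_trans (TP k).2 _; apply: le_lt_trans pN.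
by rewrite lef_pV2 ?posrE ?exprn_gt0 ?ltr0n ?prime_gt0// ler_weXn2l// ler1n prime_gt0.
Qed.

End Sphere.

Lemma divf_cancel (F : fieldType) (a b c : F) : c != 0 -> a / c / (b / c) = a / b.
Proof. by move=> c0; rewrite invf_div mulrA divfK. Qed.

(** * Distality on the sphere and bounded distortion *)

Section DistalDistortion.
Variables (p : nat) (p_pr : prime p) (n : nat).
Local Notation Qp := (Qp p_pr).
Local Notation sphere := (unit_sphere p_pr n).
Local Notation GL := (GL p_pr n).
Implicit Types (x y : sphere) (T : GL).

Lemma sphere_barE T x : set_val (sphere_bar T x) =
  ratr (mxnorm (GL_mx T *m set_val x)) *: (GL_mx T *m set_val x).
Proof. by rewrite -vnormE set_valE. Qed.

Lemma GL_mulmx_eq0 T (v : 'cV[Qp]_n) : (GL_mx T *m v == 0) = (v == 0).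
Proof.
apply/eqP/eqP => [Tv|->]; last by rewrite mulmx0.
by rewrite -(mulKmx (Defs.GL_unitmx T) v) Tv mulmx0.
Qed.

Lemma sphere_neq0 x : set_val x != 0.
Proof. by rewrite -mxnorm_eq0 mxnorm_sphere oner_eq0. Qed.

Lemma padic_abs_ratr_mxnorm (v : 'cV[Qp]_n) : v != 0 ->
  padic_abs (ratr (mxnorm v) : Qp) = (mxnorm v)^-1.
Proof. by move=> v0; rewrite -vnormE padic_abs_ratr_vnorm. Qed.

Lemma mxnorm_sphere_bar_sub T x y :
  mxnorm (GL_mx T *m set_val x) = mxnorm (GL_mx T *m set_val y) ->
  mxnorm (set_val (sphere_bar T x) - set_val (sphere_bar T y)) =
  mxnorm (GL_mx T *m (set_val x - set_val y)) / mxnorm (GL_mx T *m set_val x).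
Proof.
move=> xy; rewrite !sphere_barE -xy -scalerBr -mulmxBr mxnormZ.
by rewrite padic_abs_ratr_mxnorm ?GL_mulmx_eq0 ?sphere_neq0// mulrC.
Qed.

(** The difference of the images is [T w] with [w = s x - t y], where [s] and [t] are the
    normalizing scalars. Since |w| >= |x - y| |s| = |x - y| / |T x|, the inequality for [x] and [w]
    gives |T w| >= |x - y| / M. *)
Lemma distal_of_distortion_le (S : set GL) (M : rat) :
  (forall T, S T -> distortion_le M (GL_mx T)) -> distal_on_sphere S.
Proof.
wlog M0 : M / 0 < M => [H SM|SM].
  apply: (H (Num.max M 1)) => [|T /SM]; first by rewrite lt_max ltr01 orbT.
  by apply: distortion_leW; rewrite le_max lexx.
apply/distal_on_sphereP => x y xy.
have xy0 : 0 < mxnorm (set_val x - set_val y).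
  rewrite mxnorm_gt0 subr_eq0; apply/eqP => E; apply: xy.
  by apply: val_inj; rewrite -!set_valE.
exists (mxnorm (set_val x - set_val y) / M); first exact: divr_gt0.
move=> T ST; have Tx0 : 0 < mxnorm (GL_mx T *m set_val x).
  by rewrite mxnorm_gt0 GL_mulmx_eq0 sphere_neq0.
have Ty0 : 0 < mxnorm (GL_mx T *m set_val y).
  by rewrite mxnorm_gt0 GL_mulmx_eq0 sphere_neq0.
set s : Qp := ratr (mxnorm (GL_mx T *m set_val x)).
set t : Qp := ratr (mxnorm (GL_mx T *m set_val y)).
set w := s *: set_val x - t *: set_val y.
have sE : padic_abs s = (mxnorm (GL_mx T *m set_val x))^-1.
  by rewrite padic_abs_ratr_mxnorm// -mxnorm_gt0.
have tE : padic_abs t = (mxnorm (GL_mx T *m set_val y))^-1.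
  by rewrite padic_abs_ratr_mxnorm// -mxnorm_gt0.
have -> : set_val (sphere_bar T x) - set_val (sphere_bar T y) = GL_mx T *m w.
  by rewrite !sphere_barE /w mulmxBr -!scalemxAr.
have tsE : mxnorm (GL_mx T *m set_val x) = mxnorm (GL_mx T *m set_val y) -> t = s.
  by rewrite /s /t => ->.
clearbody s t.
have wxy : mxnorm (set_val x - set_val y) * padic_abs s <= mxnorm w.
  (* Equal norms give [s = t]. Otherwise |s| and |t| differ and the larger one is |w|, as [x] and
     [y] are unit vectors. *)
  have [E|nE] := eqVneq (mxnorm (GL_mx T *m set_val x)) (mxnorm (GL_mx T *m set_val y)).
    by rewrite /w tsE// -scalerBr mxnormZ mulrC.
  have xy1 : mxnorm (set_val x - set_val y) <= 1.
    by rewrite (le_trans (mxnormD _ _))// mxnormN !mxnorm_sphere maxxx.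
  apply: (@le_trans _ _ (padic_abs s)).
    by rewrite ler_piMl// padic_abs_ge0.
  have sx : mxnorm (s *: set_val x) = padic_abs s by rewrite mxnormZ mxnorm_sphere mulr1.
  have ty : mxnorm (- (t *: set_val y)) = padic_abs t.
    by rewrite mxnormN mxnormZ mxnorm_sphere mulr1.
  have [st|ts|st] := ltgtP (padic_abs s) (padic_abs t).
  - by rewrite /w addrC mxnormD_dominant ?sx ?ty// ltW.
  - by rewrite /w mxnormD_dominant ?sx ?ty.
  - by move: nE; rewrite -[X in X == _]invrK -sE st tE invrK eqxx.
have := SM T ST (set_val x) w; rewrite mxnorm_sphere mul1r => Mw.
rewrite ler_pdivrMr// mulrC; apply: le_trans Mw.
rewrite -ler_pdivrMl// mulrC -sE.
exact: wxy.
Qed.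

Lemma distortion_le_of_distal (S : set GL) : distal_on_sphere S ->
  exists2 M : rat, 0 <= M & forall T, S T -> distortion_le M (GL_mx T).
Proof.
move=> /distal_on_sphereP dS; apply: contrapT => /forall2NP nS.
(* Pairs of an element of [S] scaled to norm 1 and a unit vector that it nearly kills, found where
   the bound [k] on the distortion fails. *)
have /choice[Bv BvP] (k : nat) : exists Bv : 'M[Qp]_n * 'cV[Qp]_n,
    [/\ exists T c, [/\ S T, c != 0 & Bv.1 = c *: GL_mx T], mxnorm Bv.1 = 1,
      mxnorm Bv.2 = 1 & k%:R * mxnorm (Bv.1 *m Bv.2) < 1].
  have [/negP|] := nS k%:R; first by rewrite ler0n.
  move=> /existsNP[T /not_implyP[ST nT]].
  have T0 : GL_mx T != 0.
    apply: contra_notN nT => /eqP -> u v.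
    by rewrite !mul0mx mxnorm0 mul0r !mulr0.
  have [c c0 c1] := mxnorm_normalize T0.
  have : ~ distortion_le k%:R (c *: GL_mx T).
    apply: contra_not nT => /(distortion_leZ c^-1).
    by rewrite scalerA (mulVf c0) scale1r; apply.
  move=> /existsNP[u /existsNP[v /negP]].
  set B := c *: GL_mx T; rewrite -ltNge => uv.
  have v0 : v != 0.
    by apply: contraTneq uv => ->; rewrite mulmx0 !mxnorm0 !mulr0 ltxx.
  have u0 : 0 < mxnorm u.
    rewrite mxnorm_gt0.
    by apply: contraTneq uv => ->; rewrite mulmx0 !mxnorm0 !mul0r mulr0 ltxx.
  have [d d0 d1] := mxnorm_normalize v0.
  exists (B, d *: v); split=> //=; first by exists T, c.
  move: d1; rewrite -scalemxAr !mxnormZ => d1; rewrite -[ltRHS]d1 mulrCA.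
  rewrite ltr_pM2l; last by rewrite lt_def padic_abs_eq0 d0 padic_abs_ge0.
  rewrite -(ltr_pM2l u0) mulrCA; apply: (lt_le_trans uv).
  rewrite ler_wpM2r ?mxnorm_ge0//.
  by rewrite (le_trans (mxnormM _ _))// c1 mul1r.
have [|[A w] _ AwP] := compact_seq_cluster (u := Bv) (compact_setX
  (@compact_mxnorm_le1 p p_pr n n) (@compact_mxnorm_le1 p p_pr n 1)).
  by move=> k; have [_ b1 v1 _] := BvP k; split; rewrite /= ?b1 ?v1.
have near e N : 0 < e -> exists2 k, (N <= k)%N &
    mxnorm ((Bv k).1 - A) < e /\ mxnorm ((Bv k).2 - w) < e.
  move=> e0.
  apply: (AwP [set Bw | mxnorm (Bw.1 - A) < e /\ mxnorm (Bw.2 - w) < e]).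
  exists ([set B | mxnorm (B - A) < e], [set v | mxnorm (v - w) < e]) => //=.
  by split; apply/nbhs_mxnormP; exists e.
have A1 : mxnorm A = 1.
  have [k _ [BA _]] := near 1 0%N ltr01; have [_ B1 _ _] := BvP k.
  exact: mxnorm_eq1_near B1 BA.
have w1 : mxnorm w = 1.
  have [k _ [_ vw]] := near 1 0%N ltr01; have [_ _ v1 _] := BvP k.
  exact: mxnorm_eq1_near v1 vw.
(* |A w| is at most the largest of |A - B|, |w - v| and |B v| for the [k]-th pair B, v; all are at
   most [e] for some k > 1/e. *)
have Aw : A *m w = 0.
  apply/eqP; rewrite -mxnorm_eq0 eq_le mxnorm_ge0 andbT.
  apply/ler_addgt0Pr => e e0; rewrite add0r.
  have [k Nk [BA vw]] := near e (Num.bound e^-1) e0.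
  have [_ B1 v1 Bv1] := BvP k.
  rewrite -[A](subrK (Bv k).1) mulmxDl.
  apply: le_trans (mxnormD _ _) _; rewrite ge_max; apply/andP; split.
    apply: le_trans (mxnormM _ _) _; rewrite w1 mulr1 mxnormB_sym.
    exact: ltW.
  rewrite -[w](subrK (Bv k).2) mulmxDr.
  apply: le_trans (mxnormD _ _) _; rewrite ge_max; apply/andP; split.
    apply: le_trans (mxnormM _ _) _; rewrite B1 mul1r mxnormB_sym.
    exact: ltW.
  have ek : e^-1 < k%:R.
    apply: lt_le_trans (archi_boundP _) _; first by rewrite invr_ge0 ltW.
    by rewrite ler_nat.
  have k0 : 0 < k%:R :> rat by apply: lt_trans ek; rewrite invr_gt0.
  rewrite -(ler_pM2l k0); apply: (le_trans (ltW Bv1)).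
  by rewrite -ler_pdivrMr// mul1r ltW.
have A0 : A != 0 by rewrite -mxnorm_eq0 A1 oner_eq0.
have [j Aj] := exists_col_neq0 A0.
have [x xE] := sphere_mk (mxnorm_delta p_pr j).
have pw : mxnorm (p%:R *: w) < 1.
  by rewrite mxnormZ w1 mulr1 padic_abs_p invf_lt1 ?ltr0n ?ltr1n ?prime_gt0 ?prime_gt1.
(* Adding [p w], of norm 1/p, stays on the sphere and is invisible to [A]. *)
have [y yE] : exists y : sphere, set_val y = set_val x + p%:R *: w.
  by apply: sphere_mk; rewrite mxnormD_dominant mxnorm_sphere.
have xy : x <> y.
  move=> xy; move: yE; rewrite -xy => /esym/eqP.
  rewrite addrC -subr_eq0 addrK -mxnorm_eq0 mxnormZ w1 mulr1 padic_abs_p.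
  by rewrite invr_eq0 pnatr_eq0 -leqn0 leqNgt prime_gt0.
have [e e0 eS] := dS x y xy.
have Ax0 : 0 < mxnorm (A *m set_val x) by rewrite mxnorm_gt0 xE.
have Ay : A *m set_val y = A *m set_val x.
  by rewrite yE mulmxDr -scalemxAr Aw scaler0 addr0.
(* The first bound forces |B x| = |A x| = |B y|; by the second, B (x - y) = (B - A) (x - y) has norm
   below e |A x|. *)
have [|k _ [BA _]] := near (Num.min (mxnorm (A *m set_val x))
    (e * mxnorm (A *m set_val x))) 0%N.
  by rewrite lt_min Ax0 mulr_gt0.
move: BA; rewrite lt_min => /andP[BA1 BA2].
have [[T [c [ST c0 BE]]] _ _ _] := BvP k.
have Bx : mxnorm ((Bv k).1 *m set_val x) = mxnorm (A *m set_val x).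
  by apply: mxnorm_mul_near; rewrite mxnorm_sphere mulr1.
have By : mxnorm ((Bv k).1 *m set_val y) = mxnorm (A *m set_val x).
  by rewrite -Ay; apply: mxnorm_mul_near; rewrite mxnorm_sphere mulr1 Ay.
have cgt0 : 0 < padic_abs c by rewrite lt_def padic_abs_eq0 c0 padic_abs_ge0.
have TB (v : 'cV[Qp]_n) : mxnorm (GL_mx T *m v) = mxnorm ((Bv k).1 *m v) / padic_abs c.
  by rewrite BE -scalemxAl mxnormZ mulrC mulKf; [|exact: lt0r_neq0].
have := eS T ST; rewrite leNgt => /negP; apply.
rewrite mxnorm_sphere_bar_sub; last by rewrite !TB Bx By.
rewrite !TB Bx (divf_cancel _ _ (lt0r_neq0 cgt0)) ltr_pdivrMr//.
apply: le_lt_trans BA2.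
rewrite -{1}[(Bv k).1](subrK A) mulmxDl [A *m (_ - _)]mulmxBr Ay subrr addr0.
apply: le_trans (mxnormM _ _) _; rewrite -[leRHS]mulr1 ler_wpM2l ?mxnorm_ge0//.
by rewrite (le_trans (mxnormD _ _))// mxnormN !mxnorm_sphere maxxx.
Qed.

End DistalDistortion.

Lemma compact_initial (S : choiceType) (T : topologicalType) (f : S -> T)
    (K : set S) :
  compact (f @` K) -> compact (K : set (initial_topology f)).
Proof.
move=> cK F FF FK.
have FfK : (f @ F) (f @` K).
  by apply: (@filterS _ F FF K) => // y Ky; exists y.
have [_ [[x Kx <-] clx]] := cK (f @ F) _ FfK.
exists x; split=> // B V FB /nbhs_initialP[W xW WV].
have FfB : (f @ F) (f @` B) by apply: (@filterS _ F FF B) => // y By; exists y.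
by have [_ [[y By <-] Wy]] := clx _ _ FfB xW; exists y; split=> //; exact: WV.
Qed.

(** * Closures and compact sets in PGL_n *)

Section PGLClosure.
Variables (p : nat) (p_pr : prime p) (n : nat).
Local Notation Qp := (Qp p_pr).
Local Notation GL := (GL p_pr n).
Local Notation PGL := (PGL p_pr n).
Local Notation proj := (@PGL_pi p p_pr n).
Implicit Types (T U : GL) (S : set GL) (M : rat).

Lemma GL_mxM T U : GL_mx (T * U)%g = GL_mx T *m GL_mx U.
Proof. by []. Qed.

Lemma GL_mxV T : GL_mx T^-1%g = invmx (GL_mx T).
Proof. by []. Qed.

Lemma PGL_pi_eqP T U : PGL_pi T = PGL_pi U <->
  exists2 c : Qp, c != 0 & GL_mx U = c *: GL_mx T.
Proof.
split=> [/PGL_piP[c c0 cE]|[c c0 UE]].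
  by exists c => //; rewrite -[U](mulVKg T) GL_mxM cE mul_mx_scalar.
apply/PGL_piP; exists c => //.
by rewrite GL_mxM UE -scalemxAr GL_mxV mulVmx ?Defs.GL_unitmx// scalemx1.
Qed.

Lemma GL_scale T (c : Qp) : c != 0 -> exists2 U, GL_mx U = c *: GL_mx T &
  PGL_pi U = PGL_pi T.
Proof.
move=> c0; have cu : c *: GL_mx T \in unitmx.
  by rewrite unitmxZ ?unitfE// Defs.GL_unitmx.
by exists (MkGL cu) => //; apply/esym/PGL_pi_eqP; exists c.
Qed.

Lemma open_PGLP (A : set PGL) : open (proj @^-1` A) -> open A.
Proof. by []. Qed.

Lemma open_GLP (A : set GL) :
  (forall T, A T -> exists2 e : rat, 0 < e &
    forall U, mxnorm (GL_mx U - GL_mx T) < e -> A U) -> open A.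
Proof. by move=> opA; rewrite openE => T /opA ?; apply/nbhs_GLP. Qed.

(** Closure in the quotient is approximation up to scalars, which turns statements about it into
    matrix estimates. *)
Lemma closure_PGLP S T : closure (proj @` S) (PGL_pi T) <->
  forall e : rat, 0 < e -> exists U c, [/\ S U, c != 0 &
    mxnorm (c *: GL_mx U - GL_mx T) < e].
Proof.
split=> [clT e e0|clT V TV].
  (* The image of [W] is open: a small enough change of a matrix moves its multiple close to [T] by
     less than [e]. *)
  pose W := [set U | exists2 c, c != 0 & mxnorm (c *: GL_mx U - GL_mx T) < e].
  have oW : open (proj @` W).
    apply/open_PGLP/open_GLP => U' [U [c c0 UT] /PGL_pi_eqP[d d0 U'E]].
    have cd0 : 0 < padic_abs (c / d).
      rewrite lt_def padic_abs_eq0 padic_abs_ge0 andbT.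
      by rewrite mulf_neq0 ?invr_eq0.
    exists (e / padic_abs (c / d)); first exact: divr_gt0.
    move=> U''; rewrite ltr_pdivlMr// => U''e; exists U'' => //.
    exists (c / d); first by rewrite mulf_neq0 ?invr_eq0.
    rewrite -(subrKA ((c / d) *: GL_mx U')); apply: le_lt_trans (mxnormD _ _) _.
    rewrite gt_max -scalerBr mxnormZ mulrC U''e /=.
    by rewrite U'E scalerA divfK.
  have TW : nbhs (PGL_pi T) (proj @` W).
    apply: open_nbhs_nbhs; split=> //; exists T => //.
    by exists 1; rewrite ?oner_eq0// scale1r subrr mxnorm0.
  have [_ [[U SU <-] [U' [c c0 U'T] /PGL_pi_eqP[d d0 UE]]]] := clT _ TW.
  exists U, (c / d); split; first exact: SU.
    by rewrite mulf_neq0 ?invr_eq0.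
  by rewrite UE scalerA divfK.
have : nbhs T (proj @^-1` V) by exact: pi_continuous TV.
move=> /nbhs_GLP[e e0 eV]; have [U [c [SU c0 UT]]] := clT e e0.
have [U' U'E U'U] := GL_scale U c0.
exists (PGL_pi U); split; first by exists U.
by rewrite -U'U; apply: eV; rewrite U'E.
Qed.

(** Classes violating the bounds [k] would accumulate at some [x], but the condition number of a
    representative of [x] bounds the distortion on a whole neighbourhood. *)
Lemma compact_PGL_distortion_le (C : set PGL) : compact C ->
  exists M, forall T, C (PGL_pi T) -> distortion_le M (GL_mx T).
Proof.
move=> cC; apply: contrapT => /forallNP nC.
have /choice[T TP] (k : nat) : exists T,
    C (PGL_pi T) /\ ~ distortion_le k%:R (GL_mx T).
  by have /existsNP[T /not_implyP[CT nT]] := nC k%:R; exists T.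
have [x Cx clx] := compact_seq_cluster cC (fun k => (TP k).1).
set M := mxnorm (GL_mx (repr x)) * mxnorm (invmx (GL_mx (repr x))).
have xM : distortion_le M (GL_mx (repr x)).
  exact: distortion_le_condition_number (Defs.GL_unitmx _).
pose V : set PGL := proj @` [set T | distortion_le M (GL_mx T)].
have oV : open V.
  apply/open_PGLP/open_GLP => U' [U UM /PGL_pi_eqP[d d0 U'E]].
  have U'M : distortion_le M (GL_mx U') by rewrite U'E; exact: distortion_leZ.
  have [e e0 eM] := distortion_le_near M (Defs.GL_unitmx U').
  exists e; first exact: e0.
  by move=> U'' /eM U''M; exists U''; first exact: (U''M.2 U'M).
have Vx : nbhs x V.
  apply: open_nbhs_nbhs; split=> //; exists (repr x) => //; exact: PGL_reprK.
have [k Mk [U UM /PGL_pi_eqP[d d0 TE]]] := clx V Vx (Num.bound M).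
apply: (TP k).2; rewrite TE; apply: distortion_leZ; apply: distortion_leW UM.
have M0 : 0 <= M by rewrite mulr_ge0 ?mxnorm_ge0.
by rewrite ltW// (lt_le_trans (archi_boundP M0))// ler_nat.
Qed.

(** * Semigroups of bounded distortion *)

Section BoundedDistortion.
Variables (S : set GL) (M : rat).
Hypotheses (n_gt0 : (0 < n)%N) (S_semigroup : is_semigroup S) (M0 : 0 <= M)
  (SM : forall T, S T -> distortion_le M (GL_mx T)).
Let C : set PGL := closure (proj @` S).

(** Positive size matters: for [n = 0] the only matrix is zero. *)
Lemma GL_mx_neq0 T : GL_mx T != 0.
Proof.
pose j := Ordinal n_gt0.
have := GL_mulmx_eq0 T (delta_mx j 0); apply: contraPneq => ->.
rewrite mul0mx eqxx => /esym/eqP d0.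
by have := mxnorm_delta p_pr j; rewrite d0 mxnorm0 => /esym/eqP; rewrite oner_eq0.
Qed.

Lemma closure_distortion_le T : C (PGL_pi T) -> distortion_le M (GL_mx T).
Proof.
move=> /closure_PGLP CT; apply: distortion_le_limit => // e /CT[U [c [SU _ UT]]].
by exists (c *: GL_mx U) => //; apply: distortion_leZ; exact: SM.
Qed.

(** Every class in the closed set [C] has a representative in [Q], the compact set of matrices of
    norm 1 and distortion at most [M]. *)
Lemma compact_closure_PGL : compact C.
Proof.
pose Q := [set T : GL | mxnorm (GL_mx T) = 1 /\ distortion_le M (GL_mx T)].
have cQ : compact Q.
  apply: (@compact_initial _ _ (@GL_mx p p_pr n)).
  rewrite (_ : _ @` _ = [set A | mxnorm A = 1 /\ distortion_le M A]).
    exact: compact_distortion_le.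
  apply/seteqP; split=> [_ [T QT <-]//|A [A1 AM]].
  have A0 : A != 0 by rewrite -mxnorm_eq0 A1 oner_eq0.
  by exists (MkGL (distortion_le_unitmx A0 AM)).
have cpQ : compact (proj @` Q).
  apply: continuous_compact cQ; apply: continuous_subspaceT.
  exact: pi_continuous.
apply: subclosed_compact cpQ _; first exact: closed_closure.
move=> x; rewrite -(PGL_reprK x) => /closure_distortion_le xM.
have [c c0 c1] := mxnorm_normalize (GL_mx_neq0 (repr x)).
have [U UE Ux] := GL_scale (repr x) c0.
exists U; last exact: Ux.
by split; rewrite UE; [exact: c1|exact: distortion_leZ].
Qed.

Lemma closure_PGL_mul T U : C (PGL_pi T) -> C (PGL_pi U) -> C (PGL_pi (T * U)%g).
Proof.
move=> /closure_PGLP CT /closure_PGLP CU; apply/closure_PGLP => e e0.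
have N0 : 0 < mxnorm (GL_mx U) + 1 by rewrite ltr_wpDl ?mxnorm_ge0.
have [T' [c [ST' c0]]] := CT _ (divr_gt0 e0 N0); rewrite ltr_pdivlMr// => T'T.
have N'0 : 0 < mxnorm (c *: GL_mx T') + 1 by rewrite ltr_wpDl ?mxnorm_ge0.
(* Chosen after [T'], as the tolerance depends on |c T'|. *)
have [U' [d [SU' d0]]] := CU _ (divr_gt0 e0 N'0); rewrite ltr_pdivlMr// => U'U.
exists (T' * U')%g, (c * d); split; [exact: S_semigroup.2|exact: mulf_neq0|].
rewrite !GL_mxM -scalerA scalemxAr scalemxAl.
rewrite -(subrKA ((c *: GL_mx T') *m GL_mx U)) -mulmxBr -mulmxBl.
apply: le_lt_trans (mxnormD _ _) _; rewrite gt_max; apply/andP; split.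
  apply: le_lt_trans (mxnormM _ _) _; apply: le_lt_trans U'U.
  by rewrite mulrC ler_wpM2l ?mxnorm_ge0// lerDl.
apply: le_lt_trans (mxnormM _ _) _; apply: le_lt_trans T'T.
by rewrite ler_wpM2l ?mxnorm_ge0// lerDl.
Qed.

Lemma closure_PGL_exp T k : C (PGL_pi T) -> C (PGL_pi (T ^+ k.+1)%g).
Proof.
move=> CT; elim: k => [|k IHk]; first by rewrite expg1.
by rewrite expgS; exact: closure_PGL_mul.
Qed.

(* Two nearby terms c T^k, d T^l of the normalized powers of T, with l > k + 1,
   make T^(l - k - 1) close to T^-1 up to a scalar. *)
Lemma closure_PGL_inv T : C (PGL_pi T) -> C (PGL_pi T^-1%g).
Proof.
move=> CT; have /choice[c cP] (k : nat) : exists c : Qp, c != 0 /\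
    mxnorm (c *: GL_mx (T ^+ k.+1)%g) = 1.
  by have [c c0 c1] := mxnorm_normalize (GL_mx_neq0 (T ^+ k.+1)%g); exists c.
have BM k : distortion_le M (c k *: GL_mx (T ^+ k.+1)%g).
  by apply: distortion_leZ; apply: closure_distortion_le; exact: closure_PGL_exp.
have [A _ clA] := @compact_seq_cluster _ _ (fun k => c k *: GL_mx (T ^+ k.+1)%g)
  (compact_distortion_le M0) (fun k => conj (cP k).2 (BM k)).
have near e N : 0 < e -> exists2 k, (N <= k)%N &
    mxnorm (c k *: GL_mx (T ^+ k.+1)%g - A) < e.
  by move=> e0; apply: (clA [set B | mxnorm (B - A) < e]); apply/nbhs_mxnormP; exists e.
apply/closure_PGLP => e e0.
set N := M * mxnorm (GL_mx T^-1%g).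
have N0 : 0 <= N by rewrite mulr_ge0 ?mxnorm_ge0.
have N1 : 0 < N + 1 by rewrite ltr_wpDl.
have [k _ kA] := near _ 0%N (divr_gt0 e0 N1).
(* Starting at [k.+2] makes [m.+1], equal to l - k - 1, a positive exponent: only positive powers
   are known to lie in [C]. *)
have [l kl lA] := near _ k.+2 (divr_gt0 e0 N1).
pose m := (l - k.+2)%N.
have lE : l.+1 = (k.+1 + m.+1 + 1)%N by rewrite /m; lia.
pose a := (c k)^-1 * c l.
have a0 : a != 0 by rewrite mulf_neq0 ?invr_eq0 ?(cP _).1.
have key : c k *: GL_mx (T ^+ k.+1)%g *m (a *: GL_mx (T ^+ m.+1)%g - GL_mx T^-1%g) =
    (c l *: GL_mx (T ^+ l.+1)%g - c k *: GL_mx (T ^+ k.+1)%g) *m GL_mx T^-1%g.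
  rewrite mulmxBr mulmxBl; congr (_ - _).
  rewrite -scalemxAl -scalemxAr scalerA /a (mulVKf (cP k).1) -scalemxAl.
  congr (_ *: _); rewrite -!GL_mxM; congr GL_mx.
  by rewrite lE [in RHS]expgnDr expg1 mulgK expgnDr.
have am : mxnorm (a *: GL_mx (T ^+ m.+1)%g - GL_mx T^-1%g) < e.
  (* The left factor has norm 1 and distortion at most [M], so cancelling it costs a factor [M]. *)
  have := distortion_le_mulmx (a *: GL_mx (T ^+ m.+1)%g - GL_mx T^-1%g) M0 (BM k).
  rewrite (cP k).2 mul1r => /le_lt_trans; apply; rewrite key.
  apply: (@le_lt_trans _ _ (N * mxnorm (c l *: GL_mx (T ^+ l.+1)%g -
      c k *: GL_mx (T ^+ k.+1)%g))).
    rewrite /N -mulrA ler_wpM2l// mulrC; exact: mxnormM.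
  have lk : mxnorm (c l *: GL_mx (T ^+ l.+1)%g - c k *: GL_mx (T ^+ k.+1)%g) < e / (N + 1).
    rewrite -(subrKA A); apply: le_lt_trans (mxnormD _ _) _.
    by rewrite gt_max lA /= mxnormB_sym.
  move: lk; rewrite ltr_pdivlMr//; apply: le_lt_trans.
  by rewrite mulrC ler_wpM2l ?mxnorm_ge0// lerDl.
have agt0 : 0 < padic_abs a by rewrite lt_def padic_abs_eq0 a0 padic_abs_ge0.
(* The power of [T] is itself only a limit of multiples of elements of [S]; one of these replaces it
   within e / |a|. *)
have /closure_PGLP CTm := closure_PGL_exp (k := m) CT.
have [U [d [SU d0 UT]]] := CTm _ (divr_gt0 e0 agt0).
exists U, (a * d); split; [exact: SU|exact: mulf_neq0|].
rewrite -(subrKA (a *: GL_mx (T ^+ m.+1)%g)); apply: le_lt_trans (mxnormD _ _) _.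
rewrite gt_max am andbT -scalerA -scalerBr mxnormZ mulrC.
by rewrite -ltr_pdivlMr.
Qed.

Lemma is_subgroup_closure_PGL : is_subgroup C.
Proof.
have CM x y : C x -> C y -> C (x * y)%g.
  rewrite -(PGL_reprK x) -(PGL_reprK y) => Cx Cy.
  by have := closure_PGL_mul Cx Cy; rewrite -PGL_piM.
have CV x : C x -> C x^-1%g.
  rewrite -(PGL_reprK x) => Cx.
  by have := closure_PGL_inv Cx; rewrite -PGL_piV.
(* The identity arises as the product of the class of some [T] in [S] and its inverse. *)
have [T ST] := S_semigroup.1.
have CT : C (PGL_pi T) by apply: subset_closure; exists T.
by split=> //; rewrite -(mulgV (PGL_pi T)); apply: CM => //; exact: CV.
Qed.

End BoundedDistortion.
End PGLClosure.

(** * Equivalence of the three conditions *)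

Lemma generated_sub (G : groupType) (S : set G) : S `<=` generated S.
Proof. exact: sub_smallest. Qed.

Theorem theorem2p4 (p : nat) (p_pr : prime p) (n : nat) (n_gt0 : (0 < n)%N)
    (S : set (GL p_pr n)) (S_semigroup : is_semigroup S) :
  let SD : set (GL p_pr n) :=
    [set (T * d)%g | T in S & d in GL_scalar p_pr n] in
  let C : set (PGL p_pr n) := closure [set PGL_pi T | T in SD] in
  [<-> distal_on_sphere S;
       distal_on_sphere (generated S);
       compact C /\ is_subgroup C].
Proof.
move=> SD C.
have piSD : [set PGL_pi T | T in SD] = [set PGL_pi T | T in S].
  apply/seteqP; split=> [_ [_ [T ST [d dD <-] <-]]|_ [T ST <-]].
    exists T => //; apply/PGL_piP.
    by rewrite mulKg.
  exists T => //; exists T => //; exists 1%g; last exact: mulg1.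
  exact: GL_scalar1.
have SC : S `<=` [set T | C (PGL_pi T)].
  by move=> T ST; apply: subset_closure; rewrite piSD; exists T.
(* The preimage in GL_n of a subgroup [C] is a subgroup containing [S]. *)
have genC : is_subgroup C -> generated S `<=` [set T | C (PGL_pi T)].
  move=> [C1 CM CV]; apply: smallest_sub => //; split=> /= [|T U|T].
  - exact: C1.
  - by move=> CT CU; rewrite -PGL_piM; exact: CM.
  - by move=> CT; rewrite -PGL_piV; exact: CV.
have boundedC M : 0 <= M -> (forall T, S T -> distortion_le M (GL_mx T)) ->
    compact C /\ is_subgroup C.
  move=> M0 SM; rewrite /C piSD; split; first exact: compact_closure_PGL SM.
  exact: is_subgroup_closure_PGL SM.
tfae.
(* The bound on [S] makes [C] a compact group; compactness then bounds the distortion over all of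
   [C], hence over the generated group. *)
- move=> /distortion_le_of_distal[M M0 /(boundedC M M0)[cC gC]].
  have [M' CM'] := compact_PGL_distortion_le cC.
  by apply: (@distal_of_distortion_le _ _ _ _ M') => T /(genC gC)/CM'.
- move=> /distortion_le_of_distal[M M0 SM]; apply: (boundedC M M0) => T ST.
  by apply: SM; exact: generated_sub.
- move=> [/compact_PGL_distortion_le[M CM] _].
  by apply: (@distal_of_distortion_le _ _ _ _ M) => T /SC/CM.
Qed.
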